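(* The category $\mathbf{Cmp}$ of compactological sets is cartesian closed, and so is the category $\mathbf{Cmp}_\kappa$ of $\kappa$-compactological sets for every uncountable strong limit cardinal $\kappa$. Moreover, the internal hom of $\mathbf{CGWH}$ is preserved under the inclusion $\iota\colon\mathbf{CGWH}\hookrightarrow\mathbf{Cmp}$, i.e. $\iota([X,Y])\cong[\iota(X),\iota(Y)]$ for $X,Y\in\mathbf{CGWH}$.
   Context: ''Compact'' always means quasi-compact and Hausdorff. A compactological set is a triple $(X,\mathscr C,(\tau_K)_{K\in\mathscr C})$ where $X$ is a set, $\mathscr C\subseteq\mathcal P(X)$ is a non-empty collection (the compactology), and each $\tau_K$ is a topology on $K$ such that $(K,\tau_K)$ is compact and: (a) $\bigcup\mathscr C=X$; (b) for $K_1,K_2\in\mathscr C$ there is $K_3\in\mathscr C$ with $K_1\cup K_2\subseteq K_3$; (c) $\tau_{K_2}=\tau_{K_1}|_{K_2}$ for $K_2\subseteq K_1$ in $\mathscr C$; (d) compact subsets of $(K_1,\tau_{K_1})$, $K_1\in\mathscr C$, belong to $\mathscr C$. Morphisms are maps $f\colon X\to X'$ with $f(K)\in\mathscr C'$ and $f|_K\colon (K,\tau_K)\to (f(K),\tau_{f(K)})$ continuous for all $K\in\mathscr C$. This is the category $\mathbf{Cmp}$; $\mathbf{Cmp}_\kappa$ is the full subcategory of those objects with $|K|<\kappa$ for all $K\in\mathscr C$. A space $X$ is weak Hausdorff if $f(S)$ is closed for every compact $S$ and continuous $f\colon S\to X$, and compactly generated if $F\subseteq X$ is closed iff $f^{-1}(F)$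 is closed for all such $f$. $\mathbf{CGWH}$ is the (cartesian closed) category of compactly generated weak Hausdorff spaces with continuous maps. $\iota$ equips such a space with the compactology of all its compact subsets, each with the induced topology. In a cartesian closed category, $[A,B]$ denotes the internal hom (exponential), i.e. $[A,-]$ is right adjoint to $-\times A$. *)

(* Defs.v *)
From HB Require Import structures.
From mathcomp Require Import all_boot.
From mathcomp Require Import all_classical.
From mathcomp Require Import topology.

Set Implicit Arguments.
Unset Strict Implicit.
Unset Printing Implicit Defensive.

Local Open Scope classical_set_scope.

(** * Categories *)

Record category := Category {
  obj :> Type;
  hom : obj -> obj -> Type;
  idm : forall X, hom X X;
  hcomp : forall X Y Z, hom Y Z -> hom X Y -> hom X Z;
  hcomp_idl : forall X Y (f : hom X Y), hcomp (idm Y) f = f;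
  hcomp_idr : forall X Y (f : hom X Y), hcomp f (idm X) = f;
  hcompA : forall X Y Z W (h : hom Z W) (g : hom Y Z) (f : hom X Y),
    hcomp h (hcomp g f) = hcomp (hcomp h g) f }.

Arguments hom {c} _ _.
Arguments idm {c} X.
Notation "g \oc f" := (hcomp g f) (at level 50, left associativity).

Definition isomorphic (C : category) (X Y : C) : Prop :=
  exists (f : hom X Y) (g : hom Y X), g \oc f = idm X /\ f \oc g = idm Y.

Definition full_subcategory (C : category) (P : C -> Prop) : category :=
  @Category {X : C | P X} (fun X Y => hom (proj1_sig X) (proj1_sig Y))
    (fun X => idm (proj1_sig X)) (fun _ _ _ g f => g \oc f)
    (fun _ _ f => hcomp_idl f) (fun _ _ f => hcomp_idr f)
    (fun _ _ _ _ h g f => hcompA h g f).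

Record functor (C D : category) := Functor {
  fobj :> C -> D;
  fmap : forall X Y, hom X Y -> hom (fobj X) (fobj Y);
  fmap_id : forall X, fmap (idm X) = idm (fobj X);
  fmap_comp : forall X Y Z (g : hom Y Z) (f : hom X Y),
    fmap (g \oc f) = fmap g \oc fmap f }.

Record adjunction (C D : category) (F : functor C D) (G : functor D C) :=
  Adjunction {
  transpose : forall X Y, hom (F X) Y -> hom X (G Y);
  transpose_bij : forall X Y, bijective (@transpose X Y);
  transpose_natl : forall X X' Y (u : hom X' X) (f : hom (F X) Y),
    transpose (f \oc fmap F u) = transpose f \oc u;
  transpose_natr : forall X Y Y' (v : hom Y Y') (f : hom (F X) Y),
    transpose (v \oc f) = fmap G v \oc transpose f }.

Record terminal_object (C : category) := TerminalObject {
  terminal : C;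
  to_terminal : forall X, hom X terminal;
  to_terminal_uniq : forall X (f : hom X terminal), f = to_terminal X }.

Record binary_products (C : category) := BinaryProducts {
  prod_obj : C -> C -> C;
  prod_fst : forall A B, hom (prod_obj A B) A;
  prod_snd : forall A B, hom (prod_obj A B) B;
  pairing : forall Z A B, hom Z A -> hom Z B -> hom Z (prod_obj A B);
  prod_fst_pairing : forall Z A B (f : hom Z A) (g : hom Z B),
    prod_fst A B \oc pairing f g = f;
  prod_snd_pairing : forall Z A B (f : hom Z A) (g : hom Z B),
    prod_snd A B \oc pairing f g = g;
  pairing_uniq : forall Z A B (h : hom Z (prod_obj A B)),
    h = pairing (prod_fst A B \oc h) (prod_snd A B \oc h) }.

Arguments pairing {C} b {Z A B} _ _.

Section ProductFunctor.
Variables (C : category) (P : binary_products C) (A : C).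

Let prod_map X Y (u : hom X Y) : hom (prod_obj P X A) (prod_obj P Y A) :=
  pairing P (u \oc prod_fst P X A) (prod_snd P X A).

Let prod_map_id X : prod_map (idm X) = idm (prod_obj P X A).
Proof.
by rewrite [RHS]pairing_uniq /prod_map hcomp_idl !hcomp_idr.
Qed.

Let prod_map_comp X Y Z (g : hom Y Z) (f : hom X Y) :
  prod_map (g \oc f) = prod_map g \oc prod_map f.
Proof.
rewrite [RHS]pairing_uniq /prod_map !hcompA prod_fst_pairing prod_snd_pairing.
by rewrite -!hcompA prod_fst_pairing prod_snd_pairing.
Qed.

(** The functor [- x A]. *)
Definition product_functor : functor C C := Functor prod_map_id prod_map_comp.

End ProductFunctor.

Record cartesian_closed (C : category) := CartesianClosed {
  ccc_terminal : terminal_object C;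
  ccc_products : binary_products C;
  internal_hom : C -> functor C C;
  internal_hom_adj : forall A,
    adjunction (product_functor ccc_products A) (internal_hom A) }.

(** * Compact spaces *)

Definition compact_hausdorff (T : topologicalType) : Prop :=
  compact [set: T] /\ hausdorff_space T.

(* The coercion of [S] to a type carries the induced topology. The Hausdorff
   condition matters: a quasi-compact subset of a weak Hausdorff space need not
   be Hausdorff. *)
Definition compact_subset (T : topologicalType) (S : set T) : Prop :=
  compact_hausdorff S.

(** * Compactological sets *)

(* The topologies [tau_K] are data varying with [K], so a topology on a fixed
   type is a record; [space t] is the corresponding [topologicalType]. *)
Record topology (T : Type) := Topology {
  opens : set (set T);
  opens_setT : opens setT;
  opens_setI : setI_closed opens;
  opens_bigcup : forall (I : Type) (f : I -> set T),
    (forall i, opens (f i)) -> opens (\bigcup_i f i) }.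

Definition space (T : Type) (t : topology T) : Type := T.

HB.instance Definition _ (T : Type) (t : topology T) :=
  gen_eqMixin (space t).
HB.instance Definition _ (T : Type) (t : topology T) :=
  gen_choiceMixin (space t).
HB.instance Definition _ (T : Type) (t : topology T) :=
  isOpenTopological.Build (space t)
    (opens_setT t) (@opens_setI T t) (@opens_bigcup T t).

Definition topology_of (T : topologicalType) : topology T :=
  @Topology T open openT (@openI T)
    (fun I f fo => @bigcup_open T I setT f (fun i _ => fo i)).

Record compactological_set := CompactologicalSet {
  carrier :> Type;
  compactology : set (set carrier);
  top_on : forall K : set carrier, compactology K -> topology K;
  compactology_nonempty : compactology !=set0;
  top_on_compact : forall K (CK : compactology K),
    compact_hausdorff (space (top_on CK));
  compactology_cover : \bigcup_(K in compactology) K = [set: carrier];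
  compactology_directed : forall K1 K2, compactology K1 -> compactology K2 ->
    exists2 K3, compactology K3 & K1 `|` K2 `<=` K3;
  (* [subfun s : K2 -> K1] is the inclusion map. *)
  top_on_restrict : forall K1 K2 (C1 : compactology K1) (C2 : compactology K2)
    (s : K2 `<=` K1),
    opens (top_on C2) = [set subfun s @^-1` U | U in opens (top_on C1)];
  compactology_compact : forall K (CK : compactology K)
    (S : set (space (top_on CK))),
    compact_subset S -> compactology (set_val @` S) }.

Arguments compactology : clear implicits.

Definition restrict_image (X Y : Type) (f : X -> Y) (K : set X) (x : K) :
    (f @` K : set Y) :=
  exist _ (f (set_val x)) (mem_set (imageP f (set_valP x))).

Record cmp_hom (X Y : compactological_set) := CmpHom {
  cmp_fun :> X -> Y;
  cmp_hom_image : forall K,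
    compactology X K -> compactology Y (cmp_fun @` K);
  cmp_hom_cont : forall K (CK : compactology X K),
    continuous (@restrict_image _ _ cmp_fun K
      : space (top_on CK) -> space (top_on (cmp_hom_image CK))) }.

Arguments cmp_hom_image {X Y} c {K} _.
Arguments cmp_hom_cont {X Y} c {K} CK.

Section CmpHomTheory.

Lemma cmp_homP (X Y : compactological_set) (f g : cmp_hom X Y) :
  (f : X -> Y) = g -> f = g.
Proof.
case: f g => [f f1 f2] [g g1 g2] /= fg; subst g.
have e : f1 = g1 by exact: Prop_irrelevance.
by subst g1; congr CmpHom; exact: Prop_irrelevance.
Qed.

Lemma subfun_continuous (X : compactological_set) (K1 K2 : set X)
    (C1 : compactology X K1) (C2 : compactology X K2) (s : K2 `<=` K1) :
  continuous (subfun s : space (top_on C2) -> space (top_on C1)).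
Proof.
apply/continuousP => U oU; change (opens (top_on C2) (subfun s @^-1` U)).
by rewrite (top_on_restrict C1 C2 s); exists U.
Qed.

Arguments subfun_continuous {X K1 K2} C1 C2 s.

Lemma id_image (X : compactological_set) (K : set X) :
  compactology X K -> compactology X (id @` K).
Proof. by rewrite image_id. Qed.

Lemma id_cont (X : compactological_set) (K : set X) (CK : compactology X K) :
  continuous (@restrict_image _ _ id K
    : space (top_on CK) -> space (top_on (id_image CK))).
Proof.
have s : K `<=` id @` K by rewrite image_id.
rewrite (_ : @restrict_image _ _ id K = subfun s).
  exact: subfun_continuous.
by apply/funext => x; exact: val_inj.
Qed.

Definition cmp_id (X : compactological_set) : cmp_hom X X := CmpHom (@id_cont X).

Lemma comp_image (X Y Z : compactological_set) (g : cmp_hom Y Z)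
    (f : cmp_hom X Y) (K : set X) :
  compactology X K -> compactology Z ((g \o f) @` K).
Proof. by move=> CK; rewrite -image_comp; do 2 apply: cmp_hom_image. Qed.

Lemma comp_cont (X Y Z : compactological_set) (g : cmp_hom Y Z)
    (f : cmp_hom X Y) (K : set X) (CK : compactology X K) :
  continuous (@restrict_image _ _ (g \o f) K
    : space (top_on CK) -> space (top_on (comp_image g f CK))).
Proof.
have s : g @` (f @` K) `<=` (g \o f) @` K by rewrite image_comp.
rewrite (_ : @restrict_image _ _ (g \o f) K = subfun s \o
    (@restrict_image _ _ g (f @` K) \o @restrict_image _ _ f K)); last first.
  by apply/funext => x; exact: val_inj.
have cf := cmp_hom_cont f CK.
have cg := cmp_hom_cont g (cmp_hom_image f CK).
have cs := subfun_continuous (comp_image g f CK)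
  (cmp_hom_image g (cmp_hom_image f CK)) s.
move=> x; apply: (@continuous_comp (space (top_on CK))
  (space (top_on (cmp_hom_image g (cmp_hom_image f CK))))
  (space (top_on (comp_image g f CK)))); last exact: cs.
apply: (@continuous_comp (space (top_on CK))
  (space (top_on (cmp_hom_image f CK)))
  (space (top_on (cmp_hom_image g (cmp_hom_image f CK))))); first exact: cf.
exact: cg.
Qed.

Definition cmp_comp (X Y Z : compactological_set)
    (g : cmp_hom Y Z) (f : cmp_hom X Y) : cmp_hom X Z :=
  CmpHom (@comp_cont X Y Z g f).

End CmpHomTheory.

Definition Cmp : category :=
  @Category compactological_set cmp_hom cmp_id cmp_comp
    (fun X Y f => cmp_homP (erefl _ : (cmp_comp (cmp_id Y) f : X -> Y) = f))
    (fun X Y f => cmp_homP (erefl _ : (cmp_comp f (cmp_id X) : X -> Y) = f))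
    (fun X Y Z W h g f => cmp_homP (erefl _ :
      (cmp_comp h (cmp_comp g f) : X -> W) = cmp_comp (cmp_comp h g) f)).

(** * Cardinality bounds *)

Local Open Scope card_scope.

Definition card_lt (T U : Type) (A : set T) (B : set U) : Prop :=
  A #<= B /\ ~ (B #<= A).

(* The type [kappa] stands for its own cardinality. *)
Definition uncountable_strong_limit (kappa : Type) : Prop :=
  ~ countable [set: kappa] /\
  forall T : Type, card_lt [set: T] [set: kappa] ->
    card_lt [set: set T] [set: kappa].

Definition Cmp_card (kappa : Type) : category :=
  @full_subcategory Cmp (fun X =>
    forall K, compactology X K -> card_lt K [set: kappa]).

(** * Compactly generated weak Hausdorff spaces *)

Definition weak_hausdorff (X : topologicalType) : Prop :=
  forall S : topologicalType, compact_hausdorff S ->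
  forall f : S -> X, continuous f -> closed (range f).

Definition compactly_generated (X : topologicalType) : Prop :=
  forall F : set X, closed F <->
    forall S : topologicalType, compact_hausdorff S ->
    forall f : S -> X, continuous f -> closed (f @^-1` F).

Definition top_id (X : topologicalType) : continuousType X X := idfun.

Definition top_comp (X Y Z : topologicalType) (g : continuousType Y Z)
    (f : continuousType X Y) : continuousType X Z := g \o f.

Lemma top_comp_idl (X Y : topologicalType) (f : continuousType X Y) :
  top_comp (top_id Y) f = f.
Proof. exact/continuousEP. Qed.

Lemma top_comp_idr (X Y : topologicalType) (f : continuousType X Y) :
  top_comp f (top_id X) = f.
Proof. exact/continuousEP. Qed.

Lemma top_compA (X Y Z W : topologicalType) (h : continuousType Z W)
    (g : continuousType Y Z) (f : continuousType X Y) :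
  top_comp h (top_comp g f) = top_comp (top_comp h g) f.
Proof. exact/continuousEP. Qed.

Definition Top : category :=
  @Category topologicalType (fun X Y => continuousType X Y)
    top_id top_comp top_comp_idl top_comp_idr top_compA.

Definition CGWH : category :=
  @full_subcategory Top (fun X => compactly_generated X /\ weak_hausdorff X).

(** * The inclusion of [CGWH] into [Cmp] *)

Lemma set_val_continuous (T : topologicalType) (A : set T) :
  continuous (set_val : A -> T).
Proof. exact: (@initial_continuous A T set_val). Qed.

Lemma sub_continuous (T U : topologicalType) (A : set U) (f : T -> A) :
  continuous (set_val \o f) -> continuous f.
Proof.
move=> /continuousP cf; apply/continuousP => _ [V oV <-].
by have := cf _ oV; rewrite comp_preimage.
Qed.

Lemma closed_set_val (T : topologicalType) (A : set T) (F : set A) :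
  closed (set_val @` F) -> closed F.
Proof.
move=> cF; rewrite (_ : F = set_val @^-1` (set_val @` F)).
  by apply: preimage_closed => // x _; exact: set_val_continuous.
apply/seteqP; split=> [x Fx|x [y Fy /val_inj <-]//].
by exists x.
Qed.

Lemma compact_surj (T U : topologicalType) (f : T -> U) :
  continuous f -> range f = setT -> compact [set: T] -> compact [set: U].
Proof.
by move=> cf <-; apply: continuous_compact; exact: continuous_subspaceT.
Qed.

Lemma hausdorff_inj (T U : topologicalType) (f : T -> U) :
  continuous f -> injective f -> hausdorff_space U -> hausdorff_space T.
Proof.
move=> cf fI hU p q pq; apply/fI/hU => A B /cf fA /cf fB.
by have [x [Ax Bx]] := pq _ _ fA fB; exists (f x).
Qed.

Lemma compact_hausdorff_homeo (T U : topologicalType) (f : T -> U)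
    (g : U -> T) : continuous f -> continuous g -> cancel f g -> cancel g f ->
  compact_hausdorff T -> compact_hausdorff U.
Proof.
move=> cf cg fK gK [cT hT]; split.
  apply: compact_surj cf _ cT; apply/seteqP; split=> // x _.
  by exists (g x).
exact: hausdorff_inj cg (can_inj gK) hT.
Qed.

Lemma space_homeo (T : topologicalType) :
  continuous (id : T -> space (topology_of T)) /\
  continuous (id : space (topology_of T) -> T).
Proof. by split; apply/continuousP. Qed.

Lemma compact_set_type (T : topologicalType) (A : set T) :
  compact A -> compact [set: A].
Proof.
move=> cA F PF _.
have [|a [Aa aF]] := cA (set_val @ F) _.
  by apply: (@filterS _ F _ setT); [move=> x _; exact: set_valP|exact: filterT].
exists (exist _ a (mem_set Aa)); split=> // B C FB [_ [[V oV <-] /= Va VC]].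
have [] := aF (set_val @` B) V.
- by apply: (@filterS _ F _ B) => // x Bx; exists x.
- by apply: open_nbhs_nbhs; split.
by move=> _ [[x Bx <-] Vx]; exists x; split=> //; exact: VC.
Qed.

Lemma bool_compact_hausdorff : compact_hausdorff bool.
Proof. by split; [exact: bool_compact|exact: discrete_hausdorff]. Qed.

Lemma weak_hausdorff_closed1 (X : topologicalType) (x : X) :
  weak_hausdorff X -> closed [set x].
Proof.
move=> wX; have -> : [set x] = range (fun _ : bool => x).
  by apply/seteqP; split=> [_ ->|_ [_ _ <-]//]; exists true.
by apply: wX; [exact: bool_compact_hausdorff|exact: cst_continuous].
Qed.

Lemma weak_hausdorff_range (X S : topologicalType) (f : S -> X) :
  weak_hausdorff X -> compact_hausdorff S -> continuous f ->
  compact_subset (range f).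
Proof.
move=> wX [cS hS] cf.
pose g (s : S) : range f := exist _ (f s) (mem_set (imageP f I)).
have gE s : set_val (g s) = f s by [].
have cg : continuous g by exact: sub_continuous.
have sg : range g = setT.
  apply/seteqP; split=> // -[y yf] _; have [s _ fs] := set_mem yf.
  by exists s => //; exact: val_inj.
split; first exact: compact_surj cg sg cS.
have closed_map (F : set S) : closed F -> closed (g @` F).
  move=> cF; apply: closed_set_val.
  have -> : set_val @` (g @` F) = range (f \o (set_val : F -> S)).
    rewrite image_comp; apply/seteqP; split=> [_ [s Fs <-]|_ [[s sF] _ <-]].
      by exists (exist _ s (mem_set Fs)).
    by exists s => //; exact: set_mem.
  apply: wX.
    split; last exact: hausdorff_inj (@set_val_continuous _ F) val_inj hS.
    by apply: compact_set_type; exact: subclosed_compact cF cS _.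
  by move=> x; apply: continuous_comp; [exact: set_val_continuous|exact: cf].
have cl1 (y : range f) : closed [set y].
  apply: closed_set_val; rewrite image_set1; exact: weak_hausdorff_closed1.
have cfib y : closed (g @^-1` [set y]).
  by apply: preimage_closed => // x _; exact: cg.
rewrite open_hausdorff => y1 y2 /eqP y12.
have [] := compact_normal hS cS (cfib y1) (t := ~` (g @^-1` [set y2])).
  move=> s /= sy; apply: open_nbhs_nbhs; split; first exact: closed_openC.
  by move=> sy2; apply: y12; rewrite -sy -sy2.
move=> V nV cV.
pose W1 := ~` (g @` (~` V°)); pose W2 := ~` (g @` closure V).
exists (W1, W2) => /=.
  split; apply/mem_set.
    by move=> [s sV sy]; apply: sV; exact: nV.
  by move=> [s sV sy]; exact: cV sV sy.
split.
- apply/closed_openC/closed_map/open_closedC/open_interior.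
- by apply/closed_openC/closed_map/closed_closure.
apply/eqP/seteqP; split=> // y [w1 w2].
have [s _ sy] : range g y by rewrite sg.
have [sV|sV] := pselect (V° s).
  by exfalso; apply w2; exists s => //; exact: subset_closure (interior_subset sV).
by exfalso; apply w1; exists s.
Qed.

Lemma compact_subset1 (X : topologicalType) (x : X) : compact_subset [set x].
Proof.
split; first exact/compact_set_type/compact_set1.
by move=> p q _; apply: val_inj; exact: etrans (set_valP p) (esym (set_valP q)).
Qed.

Lemma compact_subset_image (X : topologicalType) (K : set X) (S : set K) :
  weak_hausdorff X -> compact_subset S -> compact_subset (set_val @` S).
Proof.
move=> wX cS; have -> : set_val @` S = range (set_val \o (set_val : S -> K)).
  apply/seteqP; split=> [_ [s Ss <-]|_ [[s sS] _ <-]].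
    by exists (exist _ s (mem_set Ss)).
  by exists s => //; exact: set_mem.
apply: weak_hausdorff_range => // x.
by apply: continuous_comp; exact: set_val_continuous.
Qed.

Lemma compact_subset_continuous (X Y : topologicalType) (f : X -> Y)
    (K : set X) : weak_hausdorff Y -> continuous f -> compact_subset K ->
  compact_subset (f @` K).
Proof.
move=> wY cf cK; have -> : f @` K = range (f \o (set_val : K -> X)).
  apply/seteqP; split=> [_ [s Ks <-]|_ [[s sK] _ <-]].
    by exists (exist _ s (mem_set Ks)).
  by exists s => //; exact: set_mem.
apply: weak_hausdorff_range => // x.
by apply: continuous_comp; [exact: set_val_continuous|exact: cf].
Qed.

Lemma compact_subsetU (X : topologicalType) (K1 K2 : set X) :
  weak_hausdorff X -> compact_subset K1 -> compact_subset K2 ->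
  compact_subset (K1 `|` K2).
Proof.
move=> wX [cK1 hK1] [cK2 hK2].
pose K (b : bool) : topologicalType := if b then K1 else K2.
pose v (b : bool) : K b -> X := if b is true then set_val else set_val.
have cv b : continuous (v b) by case: b; exact: set_val_continuous.
pose f (x : {b & K b}) : X := v (projT1 x) (projT2 x).
have cf : continuous f by apply: sigT_continuous.
have -> : K1 `|` K2 = range f.
  apply/seteqP; split=> [x [xK|xK]|_ [[[] x] _ <-]].
  - by exists (existT K true (exist _ x (mem_set xK))).
  - by exists (existT K false (exist _ x (mem_set xK))).
  - by left; exact: (set_valP x).
  - by right; exact: (set_valP x).
apply: weak_hausdorff_range => //; split.
  by apply: sigT_compact; [exact: finite_finset|case].
move=> [b x] [c y] xy.
have ebc : b = c.
  apply/eqP/negPn/negP => /eqP bc.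
  have [] := xy (existT K b @` setT) (existT K c @` setT).
  - by apply: existT_nbhs; exact: filterT.
  - by apply: existT_nbhs; exact: filterT.
  move=> _ [[x' _ <-] [y' _ e]]; apply: bc.
  exact: esym (congr1 (@projT1 _ _) e).
subst c; congr existT.
have hK : hausdorff_space (K b) by case: (b).
apply: hK => A B Ax By.
have [z [[x' Ax' <-] [y' By' e]]] :=
  xy _ _ (existT_nbhs b x A Ax) (existT_nbhs b y B By).
by exists x'; split=> //; rewrite -(existT_inj2 e).
Qed.

Section Iota.
Variables (X : topologicalType) (wX : weak_hausdorff X).

Lemma iota_nonempty : compact_subset (T := X) !=set0.
Proof.
exists set0; split; first exact/compact_set_type/compact0.
by move=> p; case: (set_valP p).
Qed.

Lemma iota_cover : \bigcup_(K in compact_subset (T := X)) K = [set: X].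
Proof.
apply/seteqP; split=> // x _; exists [set x] => //; exact: compact_subset1.
Qed.

Lemma iota_directed (K1 K2 : set X) : compact_subset K1 -> compact_subset K2 ->
  exists2 K3, compact_subset K3 & K1 `|` K2 `<=` K3.
Proof. by move=> c1 c2; exists (K1 `|` K2) => //; exact: compact_subsetU. Qed.

Lemma iota_compact (K : set X) : compact_subset K ->
  compact_hausdorff (space (topology_of K)).
Proof.
by have [c1 c2] := space_homeo K; exact: compact_hausdorff_homeo c1 c2 _ _.
Qed.

Lemma iota_restrict (K1 K2 : set X) (s : K2 `<=` K1) :
  opens (topology_of K2) =
    [set subfun s @^-1` U | U in opens (topology_of K1)].
Proof.
apply/seteqP; split=> [_ [V oV <-]|_ [_ [V oV <-] <-]].
  by exists (set_val @^-1` V) => //; exists V.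
by exists V.
Qed.

Lemma iota_compact_subset (K : set X) (S : set (space (topology_of K))) :
  compact_subset S -> compact_subset (set_val @` S).
Proof.
move=> cS; apply: (@compact_subset_image X K S wX).
have [c1 c2] := space_homeo K.
have k1 : continuous ((id : space (topology_of K) -> K) \o
    (set_val : S -> space (topology_of K))).
  by move=> x; apply: continuous_comp; [exact: set_val_continuous|exact: c2].
have k2 : continuous ((id : K -> space (topology_of K)) \o
    (set_val : (S : set K) -> K)).
  by move=> x; apply: continuous_comp; [exact: set_val_continuous|exact: c1].
have h1 := @sub_continuous S K S id k1.
have h2 := @sub_continuous (S : set K) (space (topology_of K)) S id k2.
exact: compact_hausdorff_homeo h1 h2 _ _ cS.
Qed.

Definition iota_obj : compactological_set :=
  @CompactologicalSet X (@compact_subset X) (fun K _ => topology_of K)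
    iota_nonempty iota_compact iota_cover iota_directed
    (fun K1 K2 _ _ => @iota_restrict K1 K2)
    (fun K _ => @iota_compact_subset K).

End Iota.

Lemma iota_cont (X Y : topologicalType) (f : X -> Y) (K : set X) :
  continuous f ->
  continuous (@restrict_image _ _ f K
    : space (topology_of K) -> space (topology_of (f @` K))).
Proof.
move=> cf; have c : continuous (@restrict_image _ _ f K : K -> (f @` K : set Y)).
  apply: sub_continuous; change (continuous (f \o (set_val : K -> X))) => x.
  by apply: continuous_comp; [exact: set_val_continuous|exact: cf].
by apply/continuousP => U oU; move/continuousP: c => /(_ U oU).
Qed.

Definition iota_map (X Y : CGWH) (f : hom X Y) :
    cmp_hom (iota_obj (proj2_sig X).2) (iota_obj (proj2_sig Y).2) :=
  let cf := @cts_fun (proj1_sig X) (proj1_sig Y) f in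
  @CmpHom (iota_obj (proj2_sig X).2) (iota_obj (proj2_sig Y).2) _
    (fun K => @compact_subset_continuous _ _ _ K (proj2_sig Y).2 cf)
    (fun K _ => @iota_cont _ _ _ K cf).

Lemma iota_map_id (X : CGWH) :
  iota_map (idm X) = idm (iota_obj (proj2_sig X).2 : Cmp).
Proof. exact: cmp_homP. Qed.

Lemma iota_map_comp (X Y Z : CGWH) (g : hom Y Z) (f : hom X Y) :
  iota_map (g \oc f) = (iota_map g : @hom Cmp _ _) \oc iota_map f.
Proof. exact: cmp_homP. Qed.

Definition cgwh_incl : functor CGWH Cmp :=
  @Functor CGWH Cmp (fun X => iota_obj (proj2_sig X).2) iota_map
    iota_map_id iota_map_comp.

(* Main.v *)
(* A compactological set is determined by its plots: the maps [S -> X] from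
   compact Hausdorff spaces [S] that factor continuously through a member of the
   compactology. Morphisms are the maps preserving plots, and a family of maps
   into [T] is the family of plots of a compactological set as soon as it
   contains the constants, is stable under precomposition, descends along finite
   jointly surjective families and has closed fibre products. In these terms
   products are given by pairs of plots, and the plots [S -> [X, Y]] are the
   families such that [(s, x) |-> phi s x] preserves plots. Keeping only the
   plots with range of size less than [kappa] is a coreflection onto
   [Cmp_card kappa], whence its exponentials. Finally the plots of [iota X] are
   the continuous maps [S -> X], so [iota] is fully faithful and compact
   Hausdorff spaces detect isomorphisms in [Cmp]; this alone forces [iota] to
   preserve products and then exponentials. *)

From mathcomp Require Import all_boot.
From mathcomp Require Import all_classical.
From mathcomp Require Import topology.
Require Import Defs.

Set Implicit Arguments.
Unset Strict Implicit.
Unset Printing Implicit Defensive.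

Local Open Scope classical_set_scope.

(** * Compact Hausdorff spaces *)

Lemma continuous_compT (T U V : topologicalType) (g : U -> V) (f : T -> U) :
  continuous g -> continuous f -> continuous (g \o f).
Proof. by move=> cg cf x; apply: continuous_comp; [exact: cf|exact: cg]. Qed.

Lemma continuous_open_preimage (T U : topologicalType) (f : T -> U)
    (V : set U) : continuous f -> open V -> open (f @^-1` V).
Proof. by move=> /continuousP; exact. Qed.

Lemma continuous_closed_preimage (T U : topologicalType) (f : T -> U)
    (F : set U) : continuous f -> closed F -> closed (f @^-1` F).
Proof. by move=> cf cF; apply: preimage_closed => // x _; exact: cf. Qed.

Lemma compact_hausdorffX (S T : topologicalType) :
  compact_hausdorff S -> compact_hausdorff T -> compact_hausdorff (S * T)%type.
Proof.
move=> [cS hS] [cT hT]; split; first by rewrite -setXTT; exact: compact_setX.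
move=> [p1 p2] [q1 q2] pq; congr pair.
  apply: hS => A B Ap Bq.
  have [|[x y] [/= ? ?]] := pq (fst @^-1` A) (fst @^-1` B) (cvg_fst Ap).
    exact: cvg_fst Bq.
  by exists x.
apply: hT => A B Ap Bq.
have [|[x y] [/= ? ?]] := pq (snd @^-1` A) (snd @^-1` B) (cvg_snd Ap).
  exact: cvg_snd Bq.
by exists y.
Qed.

Lemma compact_hausdorff_closed (T : topologicalType) (F : set T) :
  compact_hausdorff T -> closed F -> compact_subset F.
Proof.
move=> [cT hT] cF; split.
  exact/compact_set_type/(subclosed_compact cF cT).
exact: hausdorff_inj (@set_val_continuous _ F) val_inj hT.
Qed.

Lemma closed_coincidence (T U : topologicalType) (f g : T -> U) :
  hausdorff_space U -> continuous f -> continuous g ->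
  closed [set x | f x = g x].
Proof.
move=> hU cf cg x clx; apply: hU => A B fA gB.
have nA : nbhs x (f @^-1` A) := cf x A fA.
have nB : nbhs x (g @^-1` B) := cg x B gB.
have [y [e [Ay By]]] := clx _ (filterI nA nB).
by exists (f y); split=> //; rewrite e.
Qed.

Lemma compact_closed_map (T U : topologicalType) (f : T -> U) (F : set T) :
  compact [set: T] -> hausdorff_space U -> continuous f -> closed F ->
  closed (f @` F).
Proof.
move=> cT hU cf cF; apply: compact_closed hU _; apply: continuous_compact.
  exact: continuous_subspaceT.
exact: subclosed_compact cF cT _.
Qed.

(** Points of [U] are closed as images of closed points, so distinct points have disjoint closed
    fibres. Normality of [T] separates these fibres, and closedness of [f] carries the separation
    down to [U]. *)
Lemma closed_map_hausdorff (T U : topologicalType) (f : T -> U) :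
  compact_hausdorff T -> continuous f -> range f = setT ->
  (forall F, closed F -> closed (f @` F)) -> hausdorff_space U.
Proof.
move=> [cT hT] cf sf closed_f.
have closed_fib y : closed (f @^-1` [set y]).
  have [t _ <-] : range f y by rewrite sf.
  apply: preimage_closed => [x _|]; first exact: cf.
  rewrite -[[set f t]]image_set1; apply: closed_f.
  exact: compact_closed hT (@compact_set1 T t).
rewrite open_hausdorff => y1 y2 /eqP y12.
have [|V nV cV] :=
    compact_normal hT cT (closed_fib y1) (t := ~` (f @^-1` [set y2])).
  move=> s /= sy; apply: open_nbhs_nbhs; split; first exact: closed_openC.
  by move=> sy2; apply: y12; rewrite -sy -sy2.
(* The first set consists of the points whose fibre lies in the interior of [V], the second of those
   whose fibre misses its closure. *)
exists (~` (f @` (~` V°)), ~` (f @` closure V)) => /=.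
  split; apply/mem_set => -[s sV sy]; first exact/sV/nV.
  exact: cV sV sy.
split.
- exact/closed_openC/closed_f/open_closedC/open_interior.
- exact/closed_openC/closed_f/closed_closure.
apply/eqP/seteqP; split=> // y [w1 w2].
have [s _ sy] : range f y by rewrite sf.
have [sV|sV] := pselect (V° s).
  by apply: w2; exists s => //; exact: subset_closure (interior_subset sV).
by apply: w1; exists s.
Qed.

Record compact_space := CompactSpace {
  compact_sort :> topologicalType;
  compact_spaceP : compact_hausdorff compact_sort }.

(** The one-point space, realised inside [bool] so that [compact_subset1] supplies compactness. *)
Definition compact_point : compact_space :=
  @CompactSpace [set true] (compact_subset1 true).

Definition compact_pt : compact_point :=
  exist _ true (mem_set (erefl true : [set true] true)).

Definition compact_prod (S T : compact_space) : compact_space :=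
  CompactSpace (compact_hausdorffX (compact_spaceP S) (compact_spaceP T)).

Lemma compact_fst_continuous (S T : compact_space) :
  continuous (fst : compact_prod S T -> S).
Proof. by move=> x; exact: cvg_fst. Qed.

Lemma compact_snd_continuous (S T : compact_space) :
  continuous (snd : compact_prod S T -> T).
Proof. by move=> x; exact: cvg_snd. Qed.

Definition compact_sub (S : compact_space) (F : set S) (cF : closed F) :
    compact_space :=
  CompactSpace (compact_hausdorff_closed (compact_spaceP S) cF).

(** [F] is the union of the images of its two preimages, and continuous maps from compact to
    Hausdorff spaces are closed. *)
Lemma closed_jointly_surjective (S S1 S2 : compact_space) (q1 : S1 -> S)
    (q2 : S2 -> S) (F : set S) :
  continuous q1 -> continuous q2 -> range q1 `|` range q2 = setT ->
  closed (q1 @^-1` F) -> closed (q2 @^-1` F) -> closed F.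
Proof.
move=> c1 c2 sq F1 F2.
have -> : F = q1 @` (q1 @^-1` F) `|` q2 @` (q2 @^-1` F).
  apply/seteqP; split=> [s Fs|s [[t ? <-]|[t ? <-]]] //.
  have [[t _ ts]|[t _ ts]] : (range q1 `|` range q2) s by rewrite sq.
    by left; exists t => //=; rewrite ts.
  by right; exists t => //=; rewrite ts.
apply: closedU; apply: compact_closed_map => //;
  do ?exact: (compact_spaceP _).1.
  exact: (compact_spaceP S).2.
exact: (compact_spaceP S).2.
Qed.

Lemma sigT_bool_compact_hausdorff (S : bool -> compact_space) :
  compact_hausdorff {b & S b}.
Proof.
split.
  apply: sigT_compact => [|b]; first exact: finite_finset.
  exact: (compact_spaceP (S b)).1.
move=> [b x] [c y] xy.
have [bc|/eqP bc] := eqVneq b c; last first.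
  have [] := xy (existT S b @` setT) (existT S c @` setT).
  - by apply: existT_nbhs; exact: filterT.
  - by apply: existT_nbhs; exact: filterT.
  move=> _ [[x' _ <-] [y' _ e]]; case: bc.
  exact: esym (congr1 (@projT1 _ _) e).
subst c; congr existT; apply: (compact_spaceP (S b)).2 => A B Ax By.
have [z [[x' Ax' <-] [y' By' e]]] :=
  xy _ _ (existT_nbhs b x A Ax) (existT_nbhs b y B By).
by exists x'; split=> //; rewrite -(existT_inj2 e).
Qed.

Definition compact_sum (S : bool -> compact_space) : compact_space :=
  CompactSpace (sigT_bool_compact_hausdorff S).

(** * Fibre products of compact Hausdorff spaces over a bare set *)

Section FibreProduct.
Variables (A : Type) (S S' : compact_space) (f : S -> A) (f' : S' -> A).
Hypothesis closedR : closed [set z : compact_prod S S' | f z.1 = f' z.2].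

(** The base [A] carries no topology, so closedness of the relation is the hypothesis that makes
    this subspace of the product compact. It will come from [plot_sep] or from
    [closed_coincidence]. *)
Definition fibre_product : compact_space := compact_sub closedR.

Definition fibre_fst (z : fibre_product) : S := (set_val z).1.
Definition fibre_snd (z : fibre_product) : S' := (set_val z).2.

Lemma fibre_fst_continuous : continuous fibre_fst.
Proof.
apply: (continuous_compT (f := set_val)); last exact: set_val_continuous.
exact: compact_fst_continuous.
Qed.

Lemma fibre_snd_continuous : continuous fibre_snd.
Proof.
apply: (continuous_compT (f := set_val)); last exact: set_val_continuous.
exact: compact_snd_continuous.
Qed.

Lemma fibreP (z : fibre_product) : f (fibre_fst z) = f' (fibre_snd z).
Proof. exact: (set_valP z). Qed.

Lemma fibre_mk (s : S) (s' : S') : f s = f' s' ->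
  exists z, fibre_fst z = s /\ fibre_snd z = s'.
Proof. by move=> e; exists (exist _ (s, s') (mem_set e)). Qed.

Lemma range_fibre_fst (B : set S) :
  f @` B `<=` range f' -> B `<=` range fibre_fst.
Proof.
move=> ff' s Bs; have [|s' _ e] := ff' (f s); first by exists s.
by have [z [zs _]] := fibre_mk (esym e); exists z.
Qed.

End FibreProduct.

(** * Plots *)

(* The analogue of a quasi-separated condensed set with underlying set [T].
   [plot_cst] includes the map from the empty space, so that [T] may be empty;
   [plot_glue] combines descent along surjections and finite disjoint unions. *)
Record plot_structure (T : Type) := PlotStructure {
  plot :> forall S : compact_space, (S -> T) -> Prop;
  plot_cst : forall (S : compact_space) (f : S -> T),
    (forall s s', f s = f s') -> plot f;
  plot_comp : forall (S S' : compact_space) (f : S -> T) (u : S' -> S),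
    continuous u -> plot f -> plot (f \o u);
  plot_glue : forall (S S1 S2 : compact_space) (f : S -> T) (q1 : S1 -> S)
      (q2 : S2 -> S), continuous q1 -> continuous q2 ->
    range q1 `|` range q2 = setT -> plot (f \o q1) -> plot (f \o q2) -> plot f;
  plot_sep : forall (S S' : compact_space) (f : S -> T) (f' : S' -> T),
    plot f -> plot f' ->
    closed [set z : compact_prod S S' | f z.1 = f' z.2] }.

Arguments plot {T} p {S} f.

Lemma plot_quot (T : Type) (P : plot_structure T) (S S' : compact_space)
    (f : S -> T) (q : S' -> S) :
  continuous q -> range q = setT -> plot P (f \o q) -> plot P f.
Proof. by move=> cq sq Pfq; apply: (plot_glue cq cq); rewrite ?setUid. Qed.

(** * The compactological set defined by a family of plots *)

Section PlotCompactology.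
Variables (T : Type) (P : plot_structure T).

Definition plot_compactology : set (set T) :=
  [set K | exists (S : compact_space) (f : S -> T), plot P f /\ range f = K].

(* Quantifying over all plots into [K] avoids choosing a plot onto [K], of
   which this is the quotient topology by [plot_closed]. *)
Definition plot_opens (K : set T) : set (set K) :=
  [set U | forall (S : compact_space) (f : S -> K),
    plot P (set_val \o f) -> open (f @^-1` U)].

Lemma plot_opens_setT (K : set T) : plot_opens [set: K].
Proof. by move=> S f _; rewrite preimage_setT; exact: openT. Qed.

Lemma plot_opens_setI (K : set T) : setI_closed (@plot_opens K).
Proof.
by move=> U V oU oV S f Pf; rewrite preimage_setI; apply: openI; auto.
Qed.

Lemma plot_opens_bigcup (K : set T) (I : Type) (F : I -> set K) :
  (forall i, plot_opens (F i)) -> plot_opens (\bigcup_i F i).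
Proof.
move=> oF S f Pf; rewrite preimage_bigcup; apply: bigcup_open => i _.
exact: oF.
Qed.

Definition plot_topology (K : set T) : topology K :=
  Topology (@plot_opens_setT K) (@plot_opens_setI K) (@plot_opens_bigcup K).

Local Notation sp K := (space (plot_topology K)).

Lemma plot_continuous (K : set T) (S : compact_space) (f : S -> K) :
  plot P (set_val \o f) -> continuous (f : S -> sp K).
Proof. by move=> Pf; apply/continuousP => U oU; exact: (oU S f Pf). Qed.

(** For any plot [f'] into [K], the preimage of [F] under [f'] is the projection of a closed subset
    of the fibre product of [f'] and [f]. That fibre product is compact by [plot_sep], so the
    projection is closed. *)
Lemma plot_closed (K : set T) (S : compact_space) (f : S -> K)
    (F : set (sp K)) : plot P (set_val \o f) -> range f = setT ->
  closed (f @^-1` F) -> closed F.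
Proof.
move=> Pf sf cF.
suff oF : open (~` F) by rewrite -[F]setCK; exact: open_closedC.
move=> S' f' Pf'; rewrite preimage_setC; apply: closed_openC.
have R := plot_sep Pf' Pf.
rewrite [X in closed X](_ : _ =
    fibre_fst (closedR := R) @` (fibre_snd (closedR := R) @^-1` (f @^-1` F)));
  last first.
  apply/seteqP; split=> [s' Fs'|_ [z Fz <-]].
    have [t _ ts'] : range f (f' s') by rewrite sf.
    have [|z [zs zt]] := fibre_mk R (s := s') (s' := t).
      by rewrite /= ts'.
    by exists z => //; rewrite /preimage /= zt ts'.
  by have /val_inj e := fibreP z; rewrite /preimage /= e.
apply: compact_closed_map; last 1 first.
- exact: continuous_closed_preimage (@fibre_snd_continuous _ _ _ _ _ R) cF.
- exact: (compact_spaceP _).1.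
- exact: (compact_spaceP S').2.
- exact: fibre_fst_continuous.
Qed.

Lemma plot_lift (K : set T) : plot_compactology K ->
  exists (S : compact_space) (f : S -> K),
    plot P (set_val \o f) /\ range f = setT.
Proof.
move=> [S [f [Pf fK]]]; subst K.
exists S, (fun s => exist _ (f s) (mem_set (imageP f I))); split=> //.
apply/seteqP; split=> // -[y yf] _; have [s _ fs] := set_mem yf.
by exists s => //; exact: val_inj.
Qed.

(** [K] is the quotient of a compact space by a closed equivalence relation. The saturation of a
    closed set is the projection of a closed subset of [S * S], so the quotient map is closed and
    [closed_map_hausdorff] applies. *)
Lemma plot_top_compact (K : set T) : plot_compactology K ->
  compact_hausdorff (sp K).
Proof.
move=> /plot_lift[S [f [Pf sf]]].
have cf := plot_continuous Pf.
have [cS hS] := compact_spaceP S.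
split; first exact: compact_surj cf sf cS.
apply: (closed_map_hausdorff (compact_spaceP S) cf sf) => F cF.
apply: (plot_closed Pf sf).
have -> : f @^-1` (f @` F) = snd @` (fst @^-1` F `&`
    [set z : compact_prod S S | (set_val \o f) z.1 = (set_val \o f) z.2]).
  apply/seteqP; split=> [s [t Ft ts]|s [[t u] [/= Ft /val_inj e] <-]].
    by exists (t, s) => //; split=> //=; rewrite ts.
  by exists t.
apply: compact_closed_map => //.
- exact: (compact_spaceP (compact_prod S S)).1.
- exact: compact_snd_continuous.
apply: closedI; last exact: (plot_sep Pf Pf).
exact: continuous_closed_preimage (@compact_fst_continuous S S) cF.
Qed.

(** Converse of [plot_continuous]. Pull [f] back along a plot [f0] onto [K]: the fibre product is
    closed because [K] is Hausdorff, it surjects onto [S], and over it [f] factors through [f0].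
    Descent along this surjection makes [f] a plot. *)
Lemma plot_into (K : set T) (S : compact_space) (f : S -> K) :
  plot_compactology K -> continuous (f : S -> sp K) -> plot P (set_val \o f).
Proof.
move=> CK cf; have [S0 [f0 [Pf0 sf0]]] := plot_lift CK.
have cR : closed [set z : compact_prod S S0 | (f z.1 : sp K) = f0 z.2].
  apply: closed_coincidence; first exact: (plot_top_compact CK).2.
    by apply: continuous_compT => //; exact: compact_fst_continuous.
  apply: continuous_compT; first exact: plot_continuous.
exact: compact_snd_continuous.
have sq : range (fibre_fst (closedR := cR)) = setT.
  apply/seteqP; split=> // s _; apply: range_fibre_fst (I : setT s).
  by rewrite sf0 => ? _.
refine (plot_quot (@fibre_fst_continuous _ _ _ _ _ cR) sq _).
rewrite (_ : _ \o _ = (set_val \o f0) \o fibre_snd (closedR := cR)).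
  exact: plot_comp (@fibre_snd_continuous _ _ _ _ _ cR) Pf0.
by apply/funext => z /=; congr (set_val _); exact: (fibreP z).
Qed.

Lemma plot_range (S : compact_space) (f : S -> T) :
  plot P f -> plot_compactology (range f).
Proof. by move=> Pf; exists S, f. Qed.

(** Since [T] may be empty, the witness is the empty set, the range of a plot on the empty space. *)
Lemma plot_compactology_nonempty : plot_compactology !=set0.
Proof.
pose S := compact_sub (S := compact_point) closed0.
have S0 (s : S) : False := set_valP s.
exists set0, S, (fun s => False_rect T (S0 s)); split.
  by apply: plot_cst => s s1; have := S0 s.
by apply/seteqP; split=> // y [s _ _]; have := S0 s.
Qed.

Lemma plot_compactology_cover : \bigcup_(K in plot_compactology) K = [set: T].
Proof.
apply/seteqP; split=> // x _; exists (range (fun _ : compact_point => x)).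
  exact/plot_range/plot_cst.
by exists compact_pt.
Qed.

Lemma plot_compactology_directed K1 K2 :
  plot_compactology K1 -> plot_compactology K2 ->
  exists2 K3, plot_compactology K3 & K1 `|` K2 `<=` K3.
Proof.
move=> [S1 [f1 [Pf1 <-]]] [S2 [f2 [Pf2 <-]]].
pose S (b : bool) := if b then S1 else S2.
pose f (z : compact_sum S) : T :=
  match z with existT b x => (if b return S b -> T then f1 else f2) x end.
exists (range f).
  apply: plot_range.
  apply: (plot_glue (q1 := existT S true : S1 -> compact_sum S)
    (q2 := existT S false : S2 -> compact_sum S)) => //.
  - exact: (@existT_continuous _ S true).
  - exact: (@existT_continuous _ S false).
  - by apply/seteqP; split=> // -[[] x] _; [left|right]; exists x.
move=> x [[s _ <-]|[s _ <-]].
  by exists (existT S true s).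
by exists (existT S false s).
Qed.

Lemma plot_subfun (K1 K2 : set T) (s : K2 `<=` K1) :
  continuous (subfun s : sp K2 -> sp K1).
Proof.
apply/continuousP => U oU; change (plot_opens (subfun s @^-1` U)) => S f Pf.
exact: (oU S (subfun s \o f) Pf).
Qed.

(** The inclusion is a continuous injection from a compact to a Hausdorff space, hence a closed
    embedding: an open [U] is induced by the complement of the image of its complement. *)
Lemma plot_top_restrict (K1 K2 : set T) (C1 : plot_compactology K1)
    (C2 : plot_compactology K2) (s : K2 `<=` K1) :
  opens (plot_topology K2) =
    [set subfun s @^-1` U | U in opens (plot_topology K1)].
Proof.
have cs := @plot_subfun K1 K2 s.
apply/seteqP; split=> [U oU|_ [V oV <-]]; last first.
  exact: (continuous_open_preimage cs oV).
have cU : closed (~` U : set (sp K2)) by exact: open_closedC.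
exists (~` (subfun s @` (~` U))).
  apply: (@closed_openC (sp K1)).
  exact: compact_closed_map (plot_top_compact C2).1 (plot_top_compact C1).2
    cs cU.
apply/seteqP; split=> x /=.
  by move=> nx; apply: contrapT => Ux; apply: nx; exists x.
move=> Ux [y Uy e]; apply: Uy; rewrite (_ : y = x) //.
by apply: val_inj; exact: (congr1 val e).
Qed.

Lemma plot_compactology_compact (K : set T) (CK : plot_compactology K)
    (A : set (sp K)) :
  compact_subset A -> plot_compactology (set_val @` A).
Proof.
move=> cA; have -> : set_val @` A = range (set_val \o (set_val : A -> sp K)).
  apply/seteqP; split=> [_ [x Ax <-]|_ [x _ <-]].
    by exists (exist _ x (mem_set Ax)).
  by exists (set_val x) => //; exact: set_valP.
apply: (@plot_range (CompactSpace cA)); apply: plot_into CK _.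
exact: set_val_continuous.
Qed.

Definition cmp_of_plots : compactological_set :=
  @CompactologicalSet T plot_compactology (fun K _ => plot_topology K)
    plot_compactology_nonempty plot_top_compact plot_compactology_cover
    plot_compactology_directed plot_top_restrict plot_compactology_compact.

End PlotCompactology.

(** * The plots of a compactological set *)

Section PlotsOfCmp.
Variable X : compactological_set.

Definition cmp_plot (S : compact_space) (f : S -> X) : Prop :=
  exists (K : set X) (CK : compactology X K) (g : S -> space (top_on CK)),
    continuous g /\ f = set_val \o g.

Lemma cmp_plot_cst (S : compact_space) (f : S -> X) :
  (forall s s', f s = f s') -> cmp_plot f.
Proof.
move=> fc; have [[s0 _]|S0] := pselect ([set: S] !=set0).
  have : [set: X] (f s0) by [].
  rewrite -(compactology_cover X) => -[K CK Kf].
  exists K, CK, (fun _ => exist _ (f s0) (mem_set Kf)); split.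
    exact: cst_continuous.
  by apply/funext => s; exact: fc.
have S0' (s : S) : False by apply: S0; exists s.
have [K CK] := compactology_nonempty X.
exists K, CK, (fun s => False_rect _ (S0' s)); split.
  by move=> s; case: S0'.
by apply/funext => s; case: S0'.
Qed.

Lemma cmp_plot_comp (S S' : compact_space) (f : S -> X) (u : S' -> S) :
  continuous u -> cmp_plot f -> cmp_plot (f \o u).
Proof.
move=> cu [K [CK [g [cg ->]]]]; exists K, CK, (g \o u); split=> //.
exact: continuous_compT.
Qed.

Lemma cmp_plot_widen (K1 K2 : set X) (C1 : compactology X K1)
    (C2 : compactology X K2) (S : compact_space) (g : S -> space (top_on C2)) :
  K2 `<=` K1 -> continuous g ->
  exists2 g1 : S -> space (top_on C1), continuous g1 &
    set_val \o g = set_val \o g1.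
Proof.
move=> s cg; exists (subfun s \o g : S -> space (top_on C1)) => //.
by apply: (continuous_compT (f := g)) => //; exact: subfun_continuous.
Qed.

(** By directedness both restrictions factor through one member [K], and so does [f]. Its continuity
    into [K] is checked on closed sets over the jointly surjective family. *)
Lemma cmp_plot_glue (S S1 S2 : compact_space) (f : S -> X) (q1 : S1 -> S)
    (q2 : S2 -> S) : continuous q1 -> continuous q2 ->
  range q1 `|` range q2 = setT -> cmp_plot (f \o q1) -> cmp_plot (f \o q2) ->
  cmp_plot f.
Proof.
move=> c1 c2 sq [K1 [C1 [g1 [cg1 e1]]]] [K2 [C2 [g2 [cg2 e2]]]].
have [K CK sK] := compactology_directed C1 C2.
have [h1 ch1 eh1] := cmp_plot_widen CK (fun x K1x => sK x (or_introl K1x)) cg1.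
have [h2 ch2 eh2] := cmp_plot_widen CK (fun x K2x => sK x (or_intror K2x)) cg2.
have {}e1 s : f (q1 s) = set_val (h1 s).
  by have := congr1 (@^~ s) (etrans e1 eh1).
have {}e2 s : f (q2 s) = set_val (h2 s).
  by have := congr1 (@^~ s) (etrans e2 eh2).
have Kf s : K (f s).
  have [[t _ <-]|[t _ <-]] : (range q1 `|` range q2) s by rewrite sq.
    by rewrite e1; exact: set_valP.
  by rewrite e2; exact: set_valP.
exists K, CK, (fun s => exist _ (f s) (mem_set (Kf s))); split; last first.
  exact/funext.
apply/continuous_closedP => F cF.
apply: (closed_jointly_surjective c1 c2 sq).
  rewrite [X in closed X](_ : _ = h1 @^-1` F).
    exact: (continuous_closed_preimage ch1 cF).
  by apply/funext => s; congr (F _); apply: val_inj; exact: e1.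
rewrite [X in closed X](_ : _ = h2 @^-1` F).
  exact: (continuous_closed_preimage ch2 cF).
by apply/funext => s; congr (F _); apply: val_inj; exact: e2.
Qed.

Lemma cmp_plot_sep (S S' : compact_space) (f : S -> X) (f' : S' -> X) :
  cmp_plot f -> cmp_plot f' ->
  closed [set z : compact_prod S S' | f z.1 = f' z.2].
Proof.
move=> [K1 [C1 [g1 [cg1 e1]]]] [K2 [C2 [g2 [cg2 e2]]]].
have [K CK sK] := compactology_directed C1 C2.
have [h1 ch1 eh1] := cmp_plot_widen CK (fun x K1x => sK x (or_introl K1x)) cg1.
have [h2 ch2 eh2] := cmp_plot_widen CK (fun x K2x => sK x (or_intror K2x)) cg2.
rewrite [X in closed X](_ : _ = [set z | (h1 \o fst) z = (h2 \o snd) z]).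
  apply: (closed_coincidence (top_on_compact CK).2).
    exact: continuous_compT ch1 (@compact_fst_continuous S S').
  exact: continuous_compT ch2 (@compact_snd_continuous S S').
rewrite e1 e2 eh1 eh2; apply/seteqP; split=> -[s t] /=; first by move/val_inj.
by move=> ->.
Qed.

Definition compact_top_on (K : set X) (CK : compactology X K) : compact_space :=
  CompactSpace (top_on_compact CK).

Lemma cmp_plot_val (K : set X) (CK : compactology X K) :
  cmp_plot (set_val : compact_top_on CK -> X).
Proof. by exists K, CK, id; split=> // x. Qed.

(** The range is closed in a compact Hausdorff member of the compactology, hence a compact subset of
    it, and axiom (d) applies. *)
Lemma cmp_plot_range (S : compact_space) (f : S -> X) :
  cmp_plot f -> compactology X (range f).
Proof.
move=> [K [CK [g [cg ->]]]]; rewrite -(image_comp g set_val).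
apply: (@compactology_compact X K CK (range g)).
apply: compact_hausdorff_closed.
  exact: top_on_compact.
exact: compact_closed_map (compact_spaceP S).1 (top_on_compact CK).2 cg
  closedT.
Qed.

(** Being a plot gives continuity into some member [K1], unrelated to [K]. Both embed in a common
    [K2], and axiom (c) says that the topology of [K] is induced from [K2]. *)
Lemma cmp_plot_into (S : compact_space) (K : set X) (CK : compactology X K)
    (g : S -> space (top_on CK)) : cmp_plot (set_val \o g) -> continuous g.
Proof.
move=> [K1 [C1 [g1 [cg1 e1]]]].
have [K2 C2 sK] := compactology_directed C1 CK.
have [h1 ch1 eh1] := cmp_plot_widen C2 (fun x K1x => sK x (or_introl K1x)) cg1.
have s : K `<=` K2 by move=> x Kx; apply: sK; right.
apply/continuousP => U oU.
have : opens (top_on CK) U by [].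
rewrite (top_on_restrict C2 CK s) => -[V oV <-].
rewrite [X in open X](_ : _ = h1 @^-1` V).
  exact: (continuous_open_preimage ch1 oV).
apply/funext => t; congr (V _); apply: val_inj => /=.
by have := congr1 (@^~ t) (etrans e1 eh1).
Qed.

End PlotsOfCmp.

Arguments cmp_plot X {S} f.

(** The construction adds and loses no plots, so everything about [cmp_of_plots] can be checked on
    [P]. *)
Lemma cmp_of_plotsP (T : Type) (P : plot_structure T) (S : compact_space)
    (f : S -> T) : cmp_plot (cmp_of_plots P) f <-> plot P f.
Proof.
split=> [[K [CK [g [cg ->]]]]|Pf]; first exact: plot_into CK cg.
exists (range f), (plot_range Pf).
exists (fun s => exist _ (f s) (mem_set (imageP f I))); split=> //.
exact: plot_continuous.
Qed.

Lemma cmp_hom_plot (X Y : compactological_set) (phi : cmp_hom X Y)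
    (S : compact_space) (f : S -> X) :
  cmp_plot X f -> cmp_plot Y (phi \o f).
Proof.
move=> [K [CK [g [cg ->]]]].
exists (phi @` K), (cmp_hom_image phi CK), (@restrict_image _ _ phi K \o g).
split=> //; apply: continuous_compT cg; exact: cmp_hom_cont.
Qed.

(** * Maps preserving plots are morphisms *)

Section CmpHomOfPlots.
Variables (X Y : compactological_set) (phi : X -> Y).
Hypothesis phi_plot : forall (S : compact_space) (f : S -> X),
  cmp_plot X f -> cmp_plot Y (phi \o f).

Let phi_image K : compactology X K -> compactology Y (phi @` K).
Proof.
move=> CK; have := cmp_plot_range (phi_plot (cmp_plot_val CK)).
rewrite -(image_comp set_val phi) (_ : range set_val = K) //.
apply/seteqP; split=> [_ [x _ <-]|x Kx]; first exact: set_valP.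
by exists (exist _ x (mem_set Kx)).
Qed.

Let phi_cont K (CK : compactology X K) :
  continuous (@restrict_image _ _ phi K
    : space (top_on CK) -> space (top_on (phi_image CK))).
Proof.
apply: (@cmp_plot_into Y (compact_top_on CK) _ (phi_image CK)
  (@restrict_image _ _ phi K)).
exact: (phi_plot (cmp_plot_val CK)).
Qed.

Definition cmp_hom_of_plots : cmp_hom X Y := CmpHom phi_cont.

End CmpHomOfPlots.

(** * Cartesian closedness *)

Section ProductPlots.
Variables X Y : compactological_set.

Definition product_plot (S : compact_space) (f : S -> X * Y) : Prop :=
  cmp_plot X (fst \o f) /\ cmp_plot Y (snd \o f).

Lemma product_plot_cst (S : compact_space) (f : S -> X * Y) :
  (forall s s', f s = f s') -> product_plot f.
Proof.
by move=> fc; split; apply: cmp_plot_cst => s s' /=; rewrite (fc s s').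
Qed.

Lemma product_plot_comp (S S' : compact_space) (f : S -> X * Y) (u : S' -> S) :
  continuous u -> product_plot f -> product_plot (f \o u).
Proof.
move=> cu [f1 f2].
by split; [exact: cmp_plot_comp cu f1|exact: cmp_plot_comp cu f2].
Qed.

Lemma product_plot_glue (S S1 S2 : compact_space) (f : S -> X * Y)
    (q1 : S1 -> S) (q2 : S2 -> S) : continuous q1 -> continuous q2 ->
  range q1 `|` range q2 = setT -> product_plot (f \o q1) ->
  product_plot (f \o q2) -> product_plot f.
Proof.
move=> c1 c2 sq [f11 f12] [f21 f22].
by split; [exact: cmp_plot_glue f11 f21|exact: cmp_plot_glue f12 f22].
Qed.

Lemma product_plot_sep (S S' : compact_space) (f : S -> X * Y)
    (f' : S' -> X * Y) : product_plot f -> product_plot f' ->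
  closed [set z : compact_prod S S' | f z.1 = f' z.2].
Proof.
move=> [f1 f2] [f1' f2'].
rewrite [X in closed X](_ : _ =
  [set z : compact_prod S S' | (fst \o f) z.1 = (fst \o f') z.2] `&`
  [set z : compact_prod S S' | (snd \o f) z.1 = (snd \o f') z.2]).
  by apply: closedI; exact: cmp_plot_sep.
apply/seteqP; split=> -[s t] /=; first by move=> ->.
by case: (f s) (f' t) => [x y] [x' y'] /= [-> ->].
Qed.

Definition product_plots : plot_structure (X * Y) :=
  PlotStructure product_plot_cst product_plot_comp product_plot_glue
    product_plot_sep.

End ProductPlots.

(** * Plots of the internal hom *)

Section HomPlots.
Variables X Y : compactological_set.

(** A pair of [u] and [x] is a plot of the product of [S] and [X], so this says that the uncurried
    map preserves plots. Letting [u] vary makes stability under precomposition immediate. *)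
Definition hom_plot (S : compact_space) (phi : S -> cmp_hom X Y) : Prop :=
  forall (S' : compact_space) (u : S' -> S) (x : S' -> X),
    continuous u -> cmp_plot X x -> cmp_plot Y (fun s => phi (u s) (x s)).

Lemma hom_plot_cst (S : compact_space) (phi : S -> cmp_hom X Y) :
  (forall s s', phi s = phi s') -> hom_plot phi.
Proof.
move=> pc S' u x cu px; have [[s0 _]|S0] := pselect ([set: S'] !=set0).
  rewrite (_ : (fun _ => _) = phi (u s0) \o x); first exact: cmp_hom_plot.
  by apply/funext => s /=; rewrite (pc (u s) (u s0)).
by apply: cmp_plot_cst => s; exfalso; apply: S0; exists s.
Qed.

Lemma hom_plot_comp (S S' : compact_space) (phi : S -> cmp_hom X Y)
    (u : S' -> S) : continuous u -> hom_plot phi -> hom_plot (phi \o u).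
Proof.
move=> cu Hphi T v x cv px.
by apply: (Hphi T (u \o v) x) => //; exact: continuous_compT.
Qed.

(** The covering family is pulled back along [u]: the fibre products of [T] with [S1] and [S2] over
    the Hausdorff space [S] jointly cover [T]. On each of them the hypothesis on [phi \o q] applies,
    and plots of [Y] descend. *)
Lemma hom_plot_glue (S S1 S2 : compact_space) (phi : S -> cmp_hom X Y)
    (q1 : S1 -> S) (q2 : S2 -> S) : continuous q1 -> continuous q2 ->
  range q1 `|` range q2 = setT -> hom_plot (phi \o q1) ->
  hom_plot (phi \o q2) -> hom_plot phi.
Proof.
move=> c1 c2 sq H1 H2 T u x cu px.
have closedR (S' : compact_space) (q : S' -> S) : continuous q ->
    closed [set z : compact_prod T S' | u z.1 = q z.2].
  move=> cq; apply: (closed_coincidence (compact_spaceP S).2).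
    exact: continuous_compT cu (@compact_fst_continuous T S').
  exact: continuous_compT cq (@compact_snd_continuous T S').
have plotR (S' : compact_space) (q : S' -> S) (cq : continuous q) :
    hom_plot (phi \o q) ->
    cmp_plot Y ((fun t => phi (u t) (x t)) \o
      fibre_fst (closedR := closedR S' q cq)).
  move=> Hq; rewrite (_ : _ \o _ = fun z =>
      (phi \o q) (fibre_snd (closedR := closedR S' q cq) z)
        ((x \o @fibre_fst _ _ _ _ _ _) z)).
    apply: Hq; first exact: fibre_snd_continuous.
    exact: cmp_plot_comp (@fibre_fst_continuous _ _ _ _ _ _) px.
  by apply/funext => z /=; rewrite fibreP.
apply: (cmp_plot_glue _ _ _ (plotR _ _ c1 H1) (plotR _ _ c2 H2)).
- exact: fibre_fst_continuous.
- exact: fibre_fst_continuous.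
apply/seteqP; split=> // t _.
have [[s _ e]|[s _ e]] : (range q1 `|` range q2) (u t) by rewrite sq.
- by left; have [z [zt _]] := fibre_mk (closedR _ _ c1) (esym e); exists z.
- by right; have [z [zt _]] := fibre_mk (closedR _ _ c2) (esym e); exists z.
Qed.

Lemma hom_plot_app (S : compact_space) (phi : S -> cmp_hom X Y) (x : X) :
  hom_plot phi -> cmp_plot Y (fun s => phi s x).
Proof.
by move=> Hphi; apply: (Hphi S id (fun=> x)) => [y //|]; exact: cmp_plot_cst.
Qed.

(** Morphisms agree iff they agree at every point, so the locus is an intersection of closed
    coincidence loci of evaluations. *)
Lemma hom_plot_sep (S S' : compact_space) (phi : S -> cmp_hom X Y)
    (phi' : S' -> cmp_hom X Y) : hom_plot phi -> hom_plot phi' ->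
  closed [set z : compact_prod S S' | phi z.1 = phi' z.2].
Proof.
move=> Hphi Hphi'; rewrite [X in closed X](_ : _ = \bigcap_(x : X)
    [set z : compact_prod S S' | phi z.1 x = phi' z.2 x]).
  apply: closed_bigI => x _.
  exact: cmp_plot_sep (hom_plot_app x Hphi) (hom_plot_app x Hphi').
apply/seteqP; split=> -[s t] /= e; first by move=> x _ /=; rewrite e.
by apply/cmp_homP/funext => x; exact: e.
Qed.

Definition hom_plots : plot_structure (cmp_hom X Y) :=
  PlotStructure hom_plot_cst hom_plot_comp hom_plot_glue hom_plot_sep.

End HomPlots.

Lemma closed_coincidence_unit (S S' : compact_space) (f : S -> unit)
    (f' : S' -> unit) : closed [set z : compact_prod S S' | f z.1 = f' z.2].
Proof.
rewrite [X in closed X](_ : _ = setT); first exact: closedT.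
by apply/seteqP; split=> // z _ /=; case: (f _) (f' _) => [] [].
Qed.

Definition unit_plots : plot_structure unit :=
  @PlotStructure unit (fun S f => True) (fun _ _ _ => I)
    (fun _ _ _ _ _ _ => I) (fun _ _ _ _ _ _ _ _ _ _ _ => I)
    (fun _ _ f f' _ _ => @closed_coincidence_unit _ _ f f').

Lemma unit_plots_to (X : compactological_set) (S : compact_space) (f : S -> X) :
  cmp_plot X f -> cmp_plot (cmp_of_plots unit_plots) ((fun=> tt) \o f).
Proof. by move=> _; apply/cmp_of_plotsP. Qed.

Lemma unit_plots_uniq (X : compactological_set)
    (f : cmp_hom X (cmp_of_plots unit_plots)) :
  f = cmp_hom_of_plots (@unit_plots_to X).
Proof. by apply/cmp_homP/funext => x; case: (f x). Qed.

Definition cmp_terminal : terminal_object Cmp :=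
  @TerminalObject Cmp (cmp_of_plots unit_plots) _ unit_plots_uniq.

Definition cmp_prod (X Y : compactological_set) : compactological_set :=
  cmp_of_plots (product_plots X Y).

Lemma fst_plot (X Y : compactological_set) (S : compact_space)
    (f : S -> cmp_prod X Y) : cmp_plot _ f -> cmp_plot X (fst \o f).
Proof. by move/cmp_of_plotsP => -[]. Qed.

Lemma snd_plot (X Y : compactological_set) (S : compact_space)
    (f : S -> cmp_prod X Y) : cmp_plot _ f -> cmp_plot Y (snd \o f).
Proof. by move/cmp_of_plotsP => -[]. Qed.

Lemma pair_plot (X Y : compactological_set) (S : compact_space) (f : S -> X)
    (g : S -> Y) : cmp_plot X f -> cmp_plot Y g ->
  cmp_plot (cmp_prod X Y) (fun s => (f s, g s)).
Proof. by move=> pf pg; apply/cmp_of_plotsP; split. Qed.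

Lemma pairing_plot (Z X Y : compactological_set) (f : cmp_hom Z X)
    (g : cmp_hom Z Y) (S : compact_space) (h : S -> Z) :
  cmp_plot Z h -> cmp_plot (cmp_prod X Y) ((fun z => (f z, g z)) \o h).
Proof.
by move=> ph; exact: pair_plot (cmp_hom_plot f ph) (cmp_hom_plot g ph).
Qed.

Definition cmp_fst (X Y : compactological_set) : cmp_hom (cmp_prod X Y) X :=
  cmp_hom_of_plots (@fst_plot X Y).

Definition cmp_snd (X Y : compactological_set) : cmp_hom (cmp_prod X Y) Y :=
  cmp_hom_of_plots (@snd_plot X Y).

Definition cmp_pairing (Z X Y : compactological_set) (f : cmp_hom Z X)
    (g : cmp_hom Z Y) : cmp_hom Z (cmp_prod X Y) :=
  cmp_hom_of_plots (pairing_plot f g).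

Lemma cmp_fst_pairing (Z X Y : Cmp) (f : hom Z X) (g : hom Z Y) :
  (cmp_fst X Y : @hom Cmp _ _) \oc cmp_pairing f g = f.
Proof. exact: cmp_homP. Qed.

Lemma cmp_snd_pairing (Z X Y : Cmp) (f : hom Z X) (g : hom Z Y) :
  (cmp_snd X Y : @hom Cmp _ _) \oc cmp_pairing f g = g.
Proof. exact: cmp_homP. Qed.

Lemma cmp_pairing_uniq (Z X Y : Cmp) (h : @hom Cmp Z (cmp_prod X Y)) :
  h = cmp_pairing ((cmp_fst X Y : @hom Cmp _ _) \oc h)
        ((cmp_snd X Y : @hom Cmp _ _) \oc h).
Proof. by apply/cmp_homP/funext => z /=; case: (h z). Qed.

Definition cmp_products : binary_products Cmp :=
  BinaryProducts cmp_fst_pairing cmp_snd_pairing cmp_pairing_uniq.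

(** * Exponentials and currying *)

Section InternalHom.
Variable A : compactological_set.

Definition cmp_exp (X : compactological_set) : compactological_set :=
  cmp_of_plots (hom_plots A X).

Lemma cmp_exp_map_plot (X Y : compactological_set) (v : cmp_hom X Y)
    (S : compact_space) (phi : S -> cmp_exp X) :
  cmp_plot _ phi -> cmp_plot (cmp_exp Y) (cmp_comp v \o phi).
Proof.
move=> /cmp_of_plotsP pphi; apply/cmp_of_plotsP => T u a cu pa.
exact: (cmp_hom_plot v (pphi T u a cu pa)).
Qed.

Definition cmp_exp_map (X Y : compactological_set) (v : cmp_hom X Y) :
    cmp_hom (cmp_exp X) (cmp_exp Y) :=
  cmp_hom_of_plots (cmp_exp_map_plot v).

Lemma cmp_exp_map_id (X : Cmp) : cmp_exp_map (idm X) = idm (cmp_exp X : Cmp).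
Proof. by apply/cmp_homP/funext => g; exact: cmp_homP. Qed.

Lemma cmp_exp_map_comp (X Y Z : Cmp) (g : hom Y Z) (f : hom X Y) :
  cmp_exp_map (g \oc f) = (cmp_exp_map g : @hom Cmp _ _) \oc cmp_exp_map f.
Proof. by apply/cmp_homP/funext => h; exact: cmp_homP. Qed.

Definition cmp_internal_hom : functor Cmp Cmp :=
  @Functor Cmp Cmp cmp_exp cmp_exp_map cmp_exp_map_id cmp_exp_map_comp.

Section Curry.
Variables X Y : compactological_set.

Lemma curry_app_plot (f : cmp_hom (cmp_prod X A) Y) (x : X)
    (S : compact_space) (a : S -> A) :
  cmp_plot A a -> cmp_plot Y ((fun b => f (x, b)) \o a).
Proof.
move=> pa; apply: (cmp_hom_plot f); apply: pair_plot => //.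
exact: cmp_plot_cst.
Qed.

Definition cmp_curry_app (f : cmp_hom (cmp_prod X A) Y) (x : X) : cmp_hom A Y :=
  cmp_hom_of_plots (curry_app_plot f x).

Lemma curry_plot (f : cmp_hom (cmp_prod X A) Y) (S : compact_space)
    (x : S -> X) :
  cmp_plot X x -> cmp_plot (cmp_exp Y) (cmp_curry_app f \o x).
Proof.
move=> px; apply/cmp_of_plotsP => T u a cu pa.
apply: (cmp_hom_plot f (f := fun t => (x (u t), a t))).
by apply: pair_plot => //; exact: cmp_plot_comp cu px.
Qed.

Definition cmp_curry (f : cmp_hom (cmp_prod X A) Y) : cmp_hom X (cmp_exp Y) :=
  cmp_hom_of_plots (curry_plot f).

(** A plot of the product is a pair. The first component yields a [hom_plot], which is used with [u]
    the identity on the second component. *)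
Lemma uncurry_plot (g : cmp_hom X (cmp_exp Y)) (S : compact_space)
    (h : S -> cmp_prod X A) :
  cmp_plot _ h ->
  cmp_plot Y ((fun p => (g p.1 : cmp_hom A Y) p.2) \o h).
Proof.
move=> ph; have /cmp_of_plotsP pg := cmp_hom_plot g (fst_plot ph).
by apply: (pg S id (snd \o h)) => [x //|]; exact: snd_plot.
Qed.

Definition cmp_uncurry (g : cmp_hom X (cmp_exp Y)) : cmp_hom (cmp_prod X A) Y :=
  cmp_hom_of_plots (uncurry_plot g).

Lemma cmp_curry_bij : bijective cmp_curry.
Proof.
exists cmp_uncurry => [f|g]; first by apply/cmp_homP/funext => -[].
by apply/cmp_homP/funext => x; exact: cmp_homP.
Qed.

End Curry.

Lemma cmp_curry_natl (X X' Y : Cmp) (u : hom X' X)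
    (f : hom (product_functor cmp_products A X) Y) :
  cmp_curry (f \oc fmap (product_functor cmp_products A) u) =
  (cmp_curry f : @hom Cmp X (cmp_internal_hom Y)) \oc u.
Proof. by apply/cmp_homP/funext => x; exact: cmp_homP. Qed.

Lemma cmp_curry_natr (X Y Y' : Cmp) (v : hom Y Y')
    (f : hom (product_functor cmp_products A X) Y) :
  cmp_curry (v \oc f) = fmap cmp_internal_hom v \oc cmp_curry f.
Proof. by apply/cmp_homP/funext => x; exact: cmp_homP. Qed.

Definition cmp_exp_adj :
    adjunction (product_functor cmp_products A) cmp_internal_hom :=
  @Adjunction Cmp Cmp (product_functor cmp_products A) cmp_internal_hom
    cmp_curry cmp_curry_bij cmp_curry_natl cmp_curry_natr.

End InternalHom.

Definition cmp_cartesian_closed : cartesian_closed Cmp :=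
  CartesianClosed cmp_terminal cmp_exp_adj.

(** * Cardinality bounds *)

Local Open Scope card_scope.

Lemma card_le_rel (T U : Type) (A : set T) (B : set U) (R : T -> U -> Prop) :
  (forall a, A a -> exists2 b, B b & R a b) ->
  (forall a a' b, A a -> A a' -> R a b -> R a' b -> a = a') ->
  A #<= B.
Proof.
move=> Rtot Rinj; have Rtot' (a : A) : exists b : B, R (set_val a) (set_val b).
  have [b Bb Rab] := Rtot _ (set_valP a).
  by exists (exist _ b (mem_set Bb)).
have [f fR] := choice Rtot'.
apply/card_leP/injfunPex; exists f => // a a' _ _ faa'; apply: val_inj.
apply: Rinj (set_valP a) (set_valP a') (fR a) _.
by rewrite faa'; exact: fR.
Qed.

Lemma card_le_inj (T U : Type) (A : set T) (B : set U) (f : T -> U) :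
  set_fun A B f -> set_inj A f -> A #<= B.
Proof.
move=> fAB fI; apply: (@card_le_rel _ _ _ _ (fun a b => f a = b)).
  by move=> a Aa; exists (f a) => //; exact: fAB.
by move=> a a' b Aa Aa' <- e; apply: fI; rewrite ?inE.
Qed.

(** Zorn's lemma is applied to the graphs of partial injections from [A] to [B]. A maximal one is
    defined on all of [A] or hits all of [B]. *)
Lemma card_le_total (T U : Type) (A : set T) (B : set U) :
  A #<= B \/ B #<= A.
Proof.
pose P (G : set (T * U)) :=
  [/\ (forall z, G z -> A z.1 /\ B z.2),
      (forall a b b', G (a, b) -> G (a, b') -> b = b') &
      (forall a a' b, G (a, b) -> G (a', b) -> a = a')].
have [|G [[GAB Gfun Ginj] Gmax]] := @Zorn_bigcup _ P.
  move=> F FP tF; split=> [z [G FG Gz]|a b b' [G FG Gz] [G' FG' Gz']|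
      a a' b [G FG Gz] [G' FG' Gz']].
  - by have [+ _ _] := FP _ FG; exact.
  - have [GG'|G'G] := tF _ _ FG FG'.
      by have [_ + _] := FP _ FG'; apply; [exact: GG' Gz|].
    by have [_ + _] := FP _ FG; apply; [|exact: G'G Gz'].
  - have [GG'|G'G] := tF _ _ FG FG'.
      by have [_ _ +] := FP _ FG'; apply; [exact: GG' Gz|].
    by have [_ _ +] := FP _ FG; apply; [|exact: G'G Gz'].
have [dom|/existsNP[a0 /not_implyP[Aa na]]] :=
    pselect (forall a, A a -> exists b, G (a, b)).
  left; apply: (@card_le_rel _ _ _ _ (fun a b => G (a, b))) => [a Aa|].
    by have [b Gab] := dom a Aa; exists b => //; have [] := GAB _ Gab.
  by move=> a a' b _ _; exact: Ginj.
have [ran|/existsNP[b0 /not_implyP[Bb nb]]] :=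
    pselect (forall b, B b -> exists a, G (a, b)).
  right; apply: (@card_le_rel _ _ _ _ (fun b a => G (a, b))) => [b Bb|].
    by have [a Gab] := ran b Bb; exists a => //; have [] := GAB _ Gab.
  by move=> b b' a _ _; exact: Gfun.
(* Otherwise a missed point on each side gives a proper extension of [G] that is still a partial
   injection. *)
exfalso; apply: (Gmax (G `|` [set (a0, b0)])).
  split; first by left.
  by move=> GG; apply: na; exists b0; apply: GG; right.
split=> [_ [/GAB //|->] //|x y y' [Gy|[-> ->]] [Gy'|]
  |x x' y [Gx|[-> ->]] [Gx'|]].
- exact: Gfun Gy Gy'.
- by move=> [xa _]; exfalso; apply: na; exists y; rewrite -xa.
- by exfalso; apply: na; exists y'.
- by move=> [->].
- exact: Ginj Gx Gx'.
- by move=> [_ yb]; exfalso; apply: nb; exists x; rewrite -yb.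
- by exfalso; apply: nb; exists x'.
- by move=> [->].
Qed.

Lemma card_le_setX_powerset2 (T : Type) :
  [set: T * T] #<= [set: set (set T)].
Proof.
(* The injection is the Kuratowski pair. *)
apply: (@card_le_inj _ _ _ _ (fun z : T * T =>
  [set s : set T | s = [set z.1] \/ s = [set z.1] `|` [set z.2]])) => //.
move=> [x y] [x' y'] _ _ /= e.
have sub (s : set T) : s = [set x] \/ s = [set x] `|` [set y] <->
    s = [set x'] \/ s = [set x'] `|` [set y'].
  by have := congr1 (@^~ s) e; rewrite /= => ->.
have exx : x = x'.
  change ([set x'] x); have [->|->] := (sub [set x']).2 (or_introl erefl) => //.
  by left.
subst x'; congr pair.
(* In the degenerate case [y = x], and then [y'] equals [x] as well. Otherwise the two unions agree
   and membership compares [y] with [y']. *)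
have [e1|e1] := (sub ([set x] `|` [set y])).1 (or_intror erefl).
  have yx : y = x by change ([set x] y); rewrite -e1; right.
  rewrite yx; symmetry; change ([set x] y').
  have [<-|e2] := (sub ([set x] `|` [set y'])).2 (or_intror erefl).
    by right.
  have : ([set x] `|` [set y]) y' by rewrite -e2; right.
  by rewrite yx setUid.
have : ([set x] `|` [set y']) y by rewrite -e1; right.
case=> [yx|//].
have : ([set x] `|` [set y]) y' by rewrite e1; right.
by rewrite yx setUid.
Qed.

(** * Closure properties of sets of size below a strong limit *)

Section Small.
Variables (kappa : Type) (kappaP : uncountable_strong_limit kappa).

Definition small (T : Type) (A : set T) : Prop := card_lt A [set: kappa].

Lemma small_le (T U : Type) (A : set T) (B : set U) :
  A #<= B -> small B -> small A.
Proof.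
move=> AB [Bk kB]; split; first exact: card_le_trans Bk.
by move=> kA; apply: kB; exact: card_le_trans AB.
Qed.

Lemma small_countable (T : Type) (A : set T) : countable A -> small A.
Proof.
move=> cA; have [unc _] := kappaP; split.
  apply: card_le_trans cA _; apply/infiniteP => /finite_set_countable.
  exact: unc.
by move=> kA; apply: unc; exact: sub_countable kA cA.
Qed.

Lemma small_image (T U : Type) (f : T -> U) (A : set T) :
  small A -> small (f @` A).
Proof. exact/small_le/card_image_le. Qed.

(** If [A] is the set of smaller size, the product embeds in the square of [B], hence in its double
    power set, which is small by two uses of the strong limit property. *)
Lemma small_setX (T U : Type) (A : set T) (B : set U) :
  small A -> small B -> small (A `*` B).
Proof.
wlog : T U A B / A #<= B => [th sA sB|AB _ sB].
  have [AB|BA] := card_le_total A B; first exact: th.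
  apply: small_le (th _ _ _ _ BA sB sA).
  by apply: (@card_le_inj _ _ _ _ (fun z => (z.2, z.1))) => [z [Az Bz] //|
    [x y] [x' y'] _ _ [-> ->]].
have sB' : small [set: B].
  by apply: small_le sB; rewrite (card_le_eql (card_setT B)).
have [_ lim] := kappaP.
apply: small_le (lim _ (lim _ sB')).
apply: card_le_trans (card_le_setX_powerset2 B).
have /card_leP/injfunPex[f _ fI] := AB.
apply: (@card_le_rel _ _ _ _ (fun z w => exists a b,
  [/\ z = (set_val a, set_val b) & w = (f a, b)])).
  move=> [x y] [/= Ax By].
  exists (f (exist _ x (mem_set Ax)), exist _ y (mem_set By)) => //.
  by exists (exist _ x (mem_set Ax)), (exist _ y (mem_set By)).
move=> _ _ _ _ _ [a [b [-> ->]]] [a' [b' [-> [faa' ->]]]].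
by congr (set_val _, _); apply: fI; rewrite ?inE.
Qed.

(** When both sets are nonempty, their union is covered by an image of [A * B * bool], the boolean
    selecting a coordinate. *)
Lemma small_setU (T : Type) (A B : set T) :
  small A -> small B -> small (A `|` B).
Proof.
move=> sA sB; have [->|/set0P[a Aa]] := eqVneq A set0; first by rewrite set0U.
have [->|/set0P[b Bb]] := eqVneq B set0; first by rewrite setU0.
have sAB : small (A `*` B `*` [set: bool]).
  apply: small_setX; first exact: small_setX.
  exact/small_countable/countableP.
have := small_image (fun z : T * T * bool => if z.2 then z.1.1 else z.1.2) sAB.
apply/small_le/subset_card_le => x [Ax|Bx].
  by exists ((x, b), true).
by exists ((a, x), false).
Qed.

End Small.

(** * Cartesian closedness of coreflective full subcategories *)

Section Coreflection.
Variables (C : category) (P : C -> Prop) (H : cartesian_closed C).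
Hypothesis P_terminal : P (terminal (ccc_terminal H)).
Hypothesis P_prod : forall X Y, P X -> P Y -> P (prod_obj (ccc_products H) X Y).
Variables (R : C -> C) (P_R : forall Y, P (R Y)).
Variables (eps : forall Y, hom (R Y) Y)
  (lift : forall X Y, P X -> hom X Y -> hom X (R Y)).
Hypothesis eps_lift : forall X Y (pX : P X) (f : hom X Y),
  eps Y \oc lift pX f = f.
Hypothesis lift_eps : forall X Y (pX : P X) (g : hom X (R Y)),
  lift pX (eps Y \oc g) = g.

Local Notation D := (full_subcategory P).

(** By [lift_eps], composition with [eps] is injective on morphisms from an object satisfying [P] to
    [R Y], and both sides have the same composite. *)
Lemma lift_comp X X' Y (pX : P X) (pX' : P X') (f : hom X Y) (u : hom X' X) :
  lift pX' (f \oc u) = lift pX f \oc u.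
Proof. by rewrite -[RHS](lift_eps pX') hcompA eps_lift. Qed.

Definition sub_terminal : terminal_object D :=
  @TerminalObject D (exist _ _ P_terminal)
    (fun X => to_terminal (ccc_terminal H) (proj1_sig X))
    (fun X f => to_terminal_uniq f).

Definition sub_products : binary_products D :=
  @BinaryProducts D
    (fun X Y => exist _ _ (P_prod (proj2_sig X) (proj2_sig Y)))
    (fun X Y => prod_fst _ (proj1_sig X) (proj1_sig Y))
    (fun X Y => prod_snd _ (proj1_sig X) (proj1_sig Y))
    (fun Z X Y f g => pairing (ccc_products H) f g)
    (fun Z X Y f g => prod_fst_pairing (ccc_products H) f g)
    (fun Z X Y f g => prod_snd_pairing (ccc_products H) f g)
    (fun Z X Y h => pairing_uniq h).

Section InternalHom.
Variable A : D.
Local Notation hA := (internal_hom H (proj1_sig A)).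
Local Notation tr := (transpose (internal_hom_adj H (proj1_sig A))).

(** The subcategory shares its products with [C], so the coreflection of the ambient exponential has
    the required universal property. *)
Definition sub_exp (X : D) : D := exist _ _ (P_R (hA (proj1_sig X))).

Definition sub_exp_map (X Y : D) (v : hom X Y) : hom (sub_exp X) (sub_exp Y) :=
  lift (P_R _) (fmap hA (v : @hom C _ _) \oc eps _).

Lemma sub_exp_map_id (X : D) : sub_exp_map (idm X) = idm (sub_exp X).
Proof.
transitivity (lift (P_R _) (fmap hA (idm (proj1_sig X)) \oc eps _)) => //.
rewrite fmap_id hcomp_idl.
have := lift_eps (P_R (hA (proj1_sig X))) (idm _); by rewrite hcomp_idr.
Qed.

Lemma sub_exp_map_comp (X Y Z : D) (g : hom Y Z) (f : hom X Y) :
  sub_exp_map (g \oc f) = sub_exp_map g \oc sub_exp_map f.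
Proof.
transitivity (lift (P_R _) (fmap hA (g : @hom C _ _) \oc eps _) \oc
  lift (P_R _) (fmap hA (f : @hom C _ _) \oc eps _)) => //.
rewrite -(lift_comp _ (P_R _)) -hcompA eps_lift hcompA -fmap_comp.
by [].
Qed.

Definition sub_internal_hom : functor D D :=
  Functor sub_exp_map_id sub_exp_map_comp.

Definition sub_transpose (X Y : D)
    (f : hom (product_functor sub_products A X) Y) :
    hom X (sub_internal_hom Y) :=
  lift (proj2_sig X) (tr f).

Lemma sub_transpose_bij (X Y : D) : bijective (@sub_transpose X Y).
Proof.
have [t' tK t'K] := transpose_bij (internal_hom_adj H (proj1_sig A))
  (proj1_sig X) (proj1_sig Y).
exists (fun g => t' (eps _ \oc g)) => [f|g].
  by rewrite /sub_transpose eps_lift tK.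
by rewrite /sub_transpose t'K; exact: lift_eps.
Qed.

Lemma sub_transpose_natl (X X' Y : D) (u : hom X' X)
    (f : hom (product_functor sub_products A X) Y) :
  sub_transpose (f \oc fmap (product_functor sub_products A) u) =
  sub_transpose f \oc u.
Proof.
transitivity (lift (proj2_sig X') (tr (f : @hom C _ _) \oc (u : @hom C _ _))).
  congr lift; exact: (transpose_natl (internal_hom_adj H (proj1_sig A))).
exact: lift_comp.
Qed.

Lemma sub_transpose_natr (X Y Y' : D) (v : hom Y Y')
    (f : hom (product_functor sub_products A X) Y) :
  sub_transpose (v \oc f) = fmap sub_internal_hom v \oc sub_transpose f.
Proof.
transitivity (lift (proj2_sig X) (fmap hA (v : @hom C _ _) \oc tr f)).
  congr lift; exact: (transpose_natr (internal_hom_adj H (proj1_sig A))).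
(* Factoring the transpose through [eps] produces the morphism whose lift defines [sub_exp_map]. *)
rewrite -[X in _ \oc X](eps_lift (proj2_sig X)) hcompA.
exact: lift_comp.
Qed.

End InternalHom.

Definition coreflective_cartesian_closed : cartesian_closed D :=
  CartesianClosed sub_terminal (fun A => Adjunction
    (@sub_transpose_bij A) (@sub_transpose_natl A) (@sub_transpose_natr A)).

End Coreflection.

(** * The coreflection onto kappa-compactological sets *)

Section KappaCompactological.
Variables (kappa : Type) (kappaP : uncountable_strong_limit kappa).

Definition kappa_compactological (X : Cmp) : Prop :=
  forall K, compactology X K -> card_lt K [set: kappa].

Section SmallPlots.
Variable X : compactological_set.

Definition small_plot (S : compact_space) (f : S -> X) : Prop :=
  cmp_plot X f /\ small kappa (range f).

Lemma small_plot_cst (S : compact_space) (f : S -> X) :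
  (forall s s', f s = f s') -> small_plot f.
Proof.
move=> fc; split; first exact: cmp_plot_cst.
apply: (small_countable kappaP).
have [[s0 _]|S0] := pselect ([set: S] !=set0).
  apply: (@sub_countable _ _ _ [set f s0]); last exact: countable1.
  by apply: subset_card_le => _ [s _ <-]; exact: fc.
rewrite (_ : range f = set0); first exact: countable0.
by apply/seteqP; split=> // y [s _ _]; apply: S0; exists s.
Qed.

Lemma small_plot_comp (S S' : compact_space) (f : S -> X) (u : S' -> S) :
  continuous u -> small_plot f -> small_plot (f \o u).
Proof.
move=> cu [pf sf]; split; first exact: cmp_plot_comp.
by apply: small_le sf; apply: subset_card_le => _ [s _ <-]; exists (u s).
Qed.

Lemma small_plot_glue (S S1 S2 : compact_space) (f : S -> X) (q1 : S1 -> S)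
    (q2 : S2 -> S) : continuous q1 -> continuous q2 ->
  range q1 `|` range q2 = setT -> small_plot (f \o q1) ->
  small_plot (f \o q2) -> small_plot f.
Proof.
move=> c1 c2 sq [p1 s1] [p2 s2]; split; first exact: cmp_plot_glue p1 p2.
apply: small_le (small_setU kappaP s1 s2); apply: subset_card_le => _ [s _ <-].
have [[t _ <-]|[t _ <-]] : (range q1 `|` range q2) s by rewrite sq.
  by left; exists t.
by right; exists t.
Qed.

Lemma small_plot_sep (S S' : compact_space) (f : S -> X) (f' : S' -> X) :
  small_plot f -> small_plot f' ->
  closed [set z : compact_prod S S' | f z.1 = f' z.2].
Proof. by move=> [pf _] [pf' _]; exact: cmp_plot_sep. Qed.

Definition small_plots : plot_structure X :=
  PlotStructure small_plot_cst small_plot_comp small_plot_glue small_plot_sep.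

(** The underlying set is that of [X], since constant plots are small; the compactology shrinks to
    the ranges of small plots. *)
Definition kappa_part : Cmp := cmp_of_plots small_plots.

Lemma kappa_part_kappa : kappa_compactological kappa_part.
Proof. by move=> K [S [f [[_ sf] <-]]]. Qed.

Lemma kappa_incl_plot (S : compact_space) (f : S -> kappa_part) :
  cmp_plot kappa_part f -> cmp_plot X (id \o f).
Proof. by move/cmp_of_plotsP => -[]. Qed.

Definition kappa_incl : hom kappa_part (X : Cmp) :=
  cmp_hom_of_plots kappa_incl_plot.

End SmallPlots.

Section KappaLift.
Variables X Y : Cmp.
Hypothesis pX : kappa_compactological X.

(** The range of [g] belongs to the compactology of [X], so it is small, and so is its image under
    [f]. *)
Lemma kappa_lift_plot (f : hom X Y) (S : compact_space) (g : S -> X) :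
  cmp_plot X g -> cmp_plot (kappa_part Y) (cmp_fun f \o g).
Proof.
move=> pg; apply/cmp_of_plotsP; split; first exact: cmp_hom_plot.
rewrite -(image_comp g (cmp_fun f)); apply: small_image.
exact: pX (cmp_plot_range pg).
Qed.

Definition kappa_lift (f : hom X Y) : hom X (kappa_part Y) :=
  cmp_hom_of_plots (kappa_lift_plot f).

Lemma kappa_incl_lift (f : hom X Y) : kappa_incl Y \oc kappa_lift f = f.
Proof. exact: cmp_homP. Qed.

Lemma kappa_lift_incl (g : hom X (kappa_part Y)) :
  kappa_lift (kappa_incl Y \oc g) = g.
Proof. exact: cmp_homP. Qed.

End KappaLift.

Lemma kappa_unit : kappa_compactological (terminal cmp_terminal).
Proof.
move=> K _; apply: (small_countable kappaP).
exact: (@countableP unit).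
Qed.

Lemma kappa_prod (X Y : Cmp) :
  kappa_compactological X -> kappa_compactological Y ->
  kappa_compactological (prod_obj cmp_products X Y).
Proof.
move=> kX kY _ [S [f [[p1 p2] <-]]].
have := small_setX kappaP (kX _ (cmp_plot_range p1)) (kY _ (cmp_plot_range p2)).
apply: small_le; apply: subset_card_le => _ [s _ <-].
by split; exists s.
Qed.

Definition kappa_cartesian_closed : cartesian_closed (Cmp_card kappa) :=
  @coreflective_cartesian_closed Cmp kappa_compactological cmp_cartesian_closed
    kappa_unit kappa_prod kappa_part kappa_part_kappa kappa_incl kappa_lift
    kappa_incl_lift kappa_lift_incl.

End KappaCompactological.

(** * Preservation of exponentials *)

Section ProductFunctorProjections.
Variables (C : category) (P : binary_products C) (A X Y : C) (u : hom X Y).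

Lemma product_functor_fst :
  prod_fst P Y A \oc fmap (product_functor P A) u = u \oc prod_fst P X A.
Proof. exact: prod_fst_pairing. Qed.

Lemma product_functor_snd :
  prod_snd P Y A \oc fmap (product_functor P A) u = prod_snd P X A.
Proof. exact: prod_snd_pairing. Qed.

End ProductFunctorProjections.

(** * Fully faithful functors whose values on test objects detect isomorphisms *)

Section PreserveExponentials.
Variables (C D : category) (F : functor C D).
Hypothesis F_bij : forall X Y, bijective (@fmap _ _ F X Y).
Variable test : C -> Prop.
Hypothesis test_iso : forall (A B : D) (phi : hom A B),
  (forall S, test S -> bijective (fun u : hom (F S) A => phi \oc u)) ->
  exists psi : hom B A, psi \oc phi = idm A /\ phi \oc psi = idm B.

Section PreserveProducts.
Variables (PC : binary_products C) (PD : binary_products D) (X Y : C).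

Definition product_comparison :
    hom (F (prod_obj PC X Y)) (prod_obj PD (F X) (F Y)) :=
  pairing PD (fmap F (prod_fst PC X Y)) (fmap F (prod_snd PC X Y)).

(** By full faithfulness, morphisms from [F S] to either side amount to pairs of morphisms from [S]
    to [X] and to [Y], compatibly with the comparison map. Test objects then detect that it is
    invertible. *)
Lemma product_comparison_iso :
  exists m : hom (prod_obj PD (F X) (F Y)) (F (prod_obj PC X Y)),
    m \oc product_comparison = idm _ /\ product_comparison \oc m = idm _.
Proof.
apply: test_iso => S _.
have [gX gXK gXK'] := F_bij S X; have [gY gYK gYK'] := F_bij S Y.
exists (fun w => fmap F (pairing PC (gX (prod_fst PD _ _ \oc w))
                                    (gY (prod_snd PD _ _ \oc w)))) => [u|w].
  have [g gK gK'] := F_bij S (prod_obj PC X Y).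
  rewrite -(gK' u) !hcompA prod_fst_pairing prod_snd_pairing -!fmap_comp.
  by rewrite gXK gYK -pairing_uniq.
rewrite [LHS]pairing_uniq [RHS]pairing_uniq !hcompA.
rewrite prod_fst_pairing prod_snd_pairing -!fmap_comp.
by rewrite prod_fst_pairing prod_snd_pairing gXK' gYK'.
Qed.

End PreserveProducts.

Variables (HC : cartesian_closed C) (HD : cartesian_closed D).
Local Notation m := (product_comparison (ccc_products HC) (ccc_products HD)).
Local Notation times A := (fmap (product_functor (ccc_products HC) A)).
Local Notation timesF A := (fmap (product_functor (ccc_products HD) A)).

Lemma product_comparison_nat (A X X' : C) (u : hom X' X) :
  m X A \oc fmap F (times A u) = timesF (F A) (fmap F u) \oc m X' A.
Proof.
rewrite [LHS]pairing_uniq [RHS]pairing_uniq; congr pairing.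
  rewrite !hcompA product_functor_fst prod_fst_pairing -fmap_comp.
  by rewrite product_functor_fst fmap_comp -hcompA prod_fst_pairing.
rewrite !hcompA product_functor_snd !prod_snd_pairing -fmap_comp.
by rewrite product_functor_snd.
Qed.

(** The comparison [phi] is the transpose of the image of evaluation, read through the product
    comparison. On a test object, composition with [phi] is the chain Hom(FS, FE) = Hom(S, E) =
    Hom(S x X, Y) = Hom(F(S x X), FY) = Hom(FS x FX, FY) = Hom(FS, [FX, FY]) of bijections. *)
Lemma exponentials_preserved (X Y : C) :
  isomorphic (F (internal_hom HC X Y)) (internal_hom HD (F X) (F Y)).
Proof.
set E := internal_hom HC X Y.
pose t Z := @transpose _ _ _ _ (internal_hom_adj HC X) Z Y.
pose t' Z := @transpose _ _ _ _ (internal_hom_adj HD (F X)) Z (F Y).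
have [tE tEK tEK'] : bijective (t E) by exact: transpose_bij.
pose ev := tE (idm E).
have [mE [mEK mEK']] :=
  product_comparison_iso (ccc_products HC) (ccc_products HD) E X.
pose phi : hom (F E) (internal_hom HD (F X) (F Y)) :=
  t' (F E) (fmap F ev \oc mE).
suff [psi [pK pK']] : exists psi, psi \oc phi = idm _ /\ phi \oc psi = idm _.
  by exists phi, psi.
apply: test_iso => S _.
have [g gK gK'] := F_bij S E.
have [mS [mSK mSK']] :=
  product_comparison_iso (ccc_products HC) (ccc_products HD) S X.
have [tS tSK tSK'] : bijective (t S) by exact: transpose_bij.
have phiE u : phi \oc u = t' (F S) (fmap F (tS (g u)) \oc mS).
  have ev_times : tS (g u) = ev \oc times X (g u).
    rewrite -[RHS]tSK; congr tS.
    rewrite /t transpose_natl -/(t E ev) tEK'.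
    by rewrite hcomp_idl.
  rewrite -{1}(gK' u) ev_times /phi /t' -transpose_natl; congr transpose.
  rewrite fmap_comp -!hcompA; congr (_ \oc _).
  (* Inserting [m S X \oc mS] on the right lets naturality of the comparison move it past the
     product functor, where it cancels [mE]. *)
  rewrite -[LHS]hcomp_idr -mSK' -!hcompA.
  rewrite [_ \oc (m S X \oc _)]hcompA -product_comparison_nat.
  by rewrite !hcompA mEK hcomp_idl.
apply: (@eq_bij _ _ (t' (F S) \o (fun w => w \oc mS) \o
    @fmap _ _ F _ _ \o tS \o g)); last by move=> u; rewrite phiE.
apply: bij_comp; last by exists (fmap F (Y := E)).
apply: bij_comp; last by exists (t S).
apply: bij_comp; last exact: F_bij.
apply: bij_comp; first exact: transpose_bij.
exists (fun w => w \oc m S X) => w; rewrite -hcompA.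
  by rewrite mSK hcomp_idr.
by rewrite mSK' hcomp_idr.
Qed.

End PreserveExponentials.

(** * Full faithfulness of the inclusion and detection by compact spaces *)

Lemma compact_space_cgwh (S : compact_space) :
  compactly_generated S /\ weak_hausdorff S.
Proof.
have [cS hS] := compact_spaceP S; split=> [F|T [cT hT] f cf].
  split=> [cF T _ f cf|cF]; first exact: continuous_closed_preimage cf cF.
  by apply: (cF S (compact_spaceP S) id) => x.
exact: compact_closed_map cT hS cf closedT.
Qed.

Definition cgwh_of_compact (S : compact_space) : CGWH :=
  exist _ (S : topologicalType) (compact_space_cgwh S).

Lemma iota_plotP (X : CGWH) (S : compact_space) (f : S -> proj1_sig X) :
  cmp_plot (cgwh_incl X) f <-> continuous f.
Proof.
split=> [[K [CK [g [cg ->]]]]|cf].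
  have [_ c2] := space_homeo K.
  apply: (continuous_compT (f := (id : space (topology_of K) -> K) \o g)).
    exact: set_val_continuous.
  exact: continuous_compT c2 cg.
have CK : compact_subset (range f).
  exact: weak_hausdorff_range (proj2_sig X).2 (compact_spaceP S) cf.
pose g (s : S) : range f := exist _ (f s) (mem_set (imageP f I)).
exists (range f), CK, g; split=> //.
have [c1 _] := space_homeo (range f).
apply: (continuous_compT (f := g) c1).
exact: sub_continuous.
Qed.

(** As [X] is compactly generated, continuity can be tested along continuous maps from compact
    Hausdorff spaces. These are the plots of [X], and [phi] sends them to plots of [Y], which are
    continuous. *)
Lemma iota_full (X Y : CGWH) (phi : cmp_hom (cgwh_incl X) (cgwh_incl Y)) :
  continuous (phi : proj1_sig X -> proj1_sig Y).
Proof.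
apply/continuous_closedP => F cF; apply/(proj2_sig X).1 => S cS f cf.
have pf : cmp_plot (cgwh_incl X) (f : CompactSpace cS -> _) by exact/iota_plotP.
have /iota_plotP cphi := cmp_hom_plot phi pf.
exact: continuous_closed_preimage cphi cF.
Qed.

Lemma iota_bij (X Y : CGWH) : bijective (@fmap _ _ cgwh_incl X Y).
Proof.
exists (fun phi => mkcts (@iota_full X Y phi) : @hom CGWH X Y) => [f|phi].
  exact/continuousEP.
exact: cmp_homP.
Qed.

(** A form of the Yoneda lemma: the identity of [S] is the universal plot, so plots on [S] are
    morphisms out of it. *)
Lemma hom_from_compactP (S : compact_space) (A : compactological_set)
    (f : S -> A) :
  cmp_plot A f <->
  exists phi : cmp_hom (cgwh_incl (cgwh_of_compact S)) A, f = phi.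
Proof.
split=> [pf|[phi ->]].
  have fplot (T : compact_space) (g : T -> S) :
      cmp_plot (cgwh_incl (cgwh_of_compact S)) g -> cmp_plot A (f \o g).
    move=> /(iota_plotP (X := cgwh_of_compact S)) cg.
    exact: cmp_plot_comp pf.
  by exists (@cmp_hom_of_plots (cgwh_incl (cgwh_of_compact S)) A f fplot).
apply: (cmp_hom_plot phi (f := id)).
by apply/(iota_plotP (X := cgwh_of_compact S)) => x.
Qed.

(* The point detects bijectivity, and plots lift along [phi], so that the
   inverse map preserves plots. *)
Lemma compact_test_iso (A B : Cmp) (phi : hom A B) :
  (forall S, (exists S', S = cgwh_of_compact S') ->
    bijective (fun u : hom (cgwh_incl S) A => phi \oc u)) ->
  exists psi : hom B A, psi \oc phi = idm A /\ phi \oc psi = idm B.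
Proof.
move=> phi_bij.
have plot_lift (S : compact_space) (f : S -> B) : cmp_plot B f ->
    exists2 g : S -> A, cmp_plot A g & cmp_fun phi \o g = f.
  move=> /hom_from_compactP[w fw].
  have [h _ hK] := phi_bij _ (ex_intro _ S erefl).
  exists (cmp_fun (h w)); first by apply/hom_from_compactP; exists (h w).
  by rewrite fw -[in RHS](hK w).
have plot_inj (S : compact_space) (f g : S -> A) : cmp_plot A f ->
    cmp_plot A g -> cmp_fun phi \o f = cmp_fun phi \o g -> f = g.
  move=> /hom_from_compactP[u ->] /hom_from_compactP[v ->] uv.
  have /bij_inj inj := phi_bij _ (ex_intro _ S erefl).
  by rewrite (inj u v) //; exact: cmp_homP.
have phi_inj : injective (cmp_fun phi).
  move=> a a' e.
  have := @plot_inj compact_point (fun=> a) (fun=> a').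
  move=> /(_ (cmp_plot_cst _)) /(_ (cmp_plot_cst _)) ef.
  have {}ef := ef (fun _ _ => erefl) (fun _ _ => erefl) (funext (fun=> e)).
  by have := congr1 (@^~ compact_pt) ef.
have phi_surj b : exists a, cmp_fun phi a = b.
  have [//|g _ gb] := @plot_lift compact_point (fun=> b) (cmp_plot_cst _).
  by exists (g compact_pt); have := congr1 (@^~ compact_pt) gb.
have [psi psiK] := choice phi_surj.
have phiK : cancel (cmp_fun phi) psi by move=> a; apply: phi_inj; rewrite psiK.
have psi_plot (S : compact_space) (f : S -> B) :
    cmp_plot B f -> cmp_plot A (psi \o f).
  move=> /plot_lift[g pg <-]; rewrite (_ : psi \o _ = g) //.
  by apply/funext => s; exact: phiK.
by exists (cmp_hom_of_plots psi_plot); split; apply/cmp_homP/funext.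
Qed.

Theorem proposition4p3 :
  inhabited (cartesian_closed Cmp) /\
  (forall kappa : Type, uncountable_strong_limit kappa ->
    inhabited (cartesian_closed (Cmp_card kappa))) /\
  (forall (H : cartesian_closed CGWH) (H' : cartesian_closed Cmp)
      (X Y : CGWH),
    isomorphic (cgwh_incl (internal_hom H X Y))
      (internal_hom H' (cgwh_incl X) (cgwh_incl Y))).
Proof.
split; first exact: inhabits cmp_cartesian_closed.
split=> [kappa kappaP|H H' X Y].
  exact: inhabits (kappa_cartesian_closed kappaP).
exact: (exponentials_preserved iota_bij compact_test_iso H H' X Y).
Qed.
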